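(* Let $n\ge2$ and $s\le\frac n2-1$. Then for every real $b<\frac12$ there is no constant $C$ such that $$\|f\bar gh\|_{X^{s,-b}}\le C\|f\|_{X^{s,b}}\|g\|_{X^{s,b}}\|h\|_{X^{s,b}}$$ holds for all $f,g,h\in X^{s,b}(\mathbb{R}^{n+1})$.
   Context: For $u$ on $\mathbb{R}^n\times\mathbb{R}$ with space-time Fourier transform $\widehat u(\xi,\tau)$: $\|u\|_{X^{s,b}}^2=\int_{\mathbb{R}^{n+1}}(1+|\xi|)^{2s}(1+|\tau+|\xi|^2|)^{2b}|\widehat u(\xi,\tau)|^2d\xi d\tau$. $\bar g$ denotes complex conjugation. *)

(* Defs.v *)
From HB Require Import structures.
From mathcomp Require Import all_boot all_order all_algebra.
From mathcomp Require Import all_classical all_reals all_analysis.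
From mathcomp Require Import complex.
Set Implicit Arguments. Unset Strict Implicit. Unset Printing Implicit Defensive.
Import Order.TTheory GRing.Theory Num.Theory.
Import numFieldNormedType.Exports.
Local Open Scope ring_scope.
Local Open Scope complex_scope.

Section XsbDefs.
Variable R : realType.

(* Iterated (coordinate-by-coordinate) Lebesgue integral over R^N,
   extended-real valued (used for nonnegative integrands). *)
Fixpoint iintE (N : nat) : ('rV[R]_N -> \bar R) -> \bar R :=
  match N with
  | 0 => fun F => F 0
  | N'.+1 => fun F =>
      (\int[@lebesgue_measure R]_(x in setT)
         iintE (fun v : 'rV[R]_N' => F (row_mx (\row_(j < 1) x) v)))%E
  end.

(* Iterated real-valued Lebesgue integral over R^N (used for integrable,
   here Schwartz-class, integrands). *)
Fixpoint iintR (N : nat) : ('rV[R]_N -> R) -> R :=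
  match N with
  | 0 => fun F => F 0
  | N'.+1 => fun F =>
      Rintegral (@lebesgue_measure R) setT
        (fun x => iintR (fun v : 'rV[R]_N' => F (row_mx (\row_(j < 1) x) v)))
  end.

Definition dotR (N : nat) (x y : 'rV[R]_N) : R := \sum_(i < N) x 0 i * y 0 i.
Definition enorm (N : nat) (x : 'rV[R]_N) : R := Num.sqrt (dotR x x).

Fixpoint iderive (N : nat) (vs : seq 'rV[R]_N) (f : 'rV[R]_N -> R)
  : 'rV[R]_N -> R :=
  match vs with
  | [::] => f
  | v :: vs' => fun x => derive (iderive vs' f) x v
  end.

Definition schwartzR (N : nat) (f : 'rV[R]_N -> R) : Prop :=
  forall vs : seq 'rV[R]_N,
    (forall (v x : 'rV[R]_N), derivable (iderive vs f) x v) /\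
    (forall k : nat, exists M : R, forall x : 'rV[R]_N,
        (1 + enorm x) ^+ k * `|iderive vs f x| <= M).

Definition schwartz (N : nat) (u : 'rV[R]_N -> R[i]) : Prop :=
  schwartzR (fun x => complex.Re (u x)) /\ schwartzR (fun x => complex.Im (u x)).

(* Fourier transform  \hat u(w) = \int e^{-i z.w} u(z) dz, real and imaginary parts *)
Definition fourierRe (N : nat) (u : 'rV[R]_N -> R[i]) (w : 'rV[R]_N) : R :=
  iintR (fun z => complex.Re (u z) * cos (dotR z w) + complex.Im (u z) * sin (dotR z w)).
Definition fourierIm (N : nat) (u : 'rV[R]_N -> R[i]) (w : 'rV[R]_N) : R :=
  iintR (fun z => complex.Im (u z) * cos (dotR z w) - complex.Re (u z) * sin (dotR z w)).

(* Space-time R^n x R is 'rV_(n.+1): first n coordinates = space, last = time. *)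
Definition spc (n : nat) (w : 'rV[R]_n.+1) : 'rV[R]_n :=
  \row_(i < n) w 0 (widen_ord (leqnSn n) i).
Definition tim (n : nat) (w : 'rV[R]_n.+1) : R := w 0 ord_max.

Definition Xweight (n : nat) (s b : R) (w : 'rV[R]_n.+1) : R :=
  powR (1 + enorm (spc w)) (2 * s) *
  powR (1 + `|tim w + enorm (spc w) ^+ 2|) (2 * b).

Definition XnormSq (n : nat) (s b : R) (u : 'rV[R]_n.+1 -> R[i]) : \bar R :=
  iintE (fun w => (Xweight s b w * (fourierRe u w ^+ 2 + fourierIm u w ^+ 2))%:E).

(* ||u||_{X^{s,b}} (finite for Schwartz u) *)
Definition Xnorm (n : nat) (s b : R) (u : 'rV[R]_n.+1 -> R[i]) : R :=
  Num.sqrt (fine (XnormSq s b u)).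

End XsbDefs.

(* Main.v *)
Require Import Defs.
From HB Require Import structures.
From mathcomp Require Import all_boot all_order all_algebra.
From mathcomp Require Import all_classical all_reals all_analysis.
From mathcomp Require Import complex.
From mathcomp Require Import measurable_realfun.
From mathcomp Require Import ring lra.
Import Order.TTheory GRing.Theory Num.Theory.
Import numFieldNormedType.Exports.
Local Open Scope classical_set_scope.
Local Open Scope ring_scope.

(** Take f = g = h a Gaussian wave packet whose Fourier transform is a Gaussian
    centred at (K L e_1, 0) with width L in the frequency variables and L^2 in
    the time-frequency variable; then f * conj f * f is a packet of the same kind.
    The inhomogeneous weights are of size (L K)^(2 s) and (L K)^(4 b) on the bulk
    of the packet, and for s < 0 the Gaussian tail reaching the origin costs only
    exp (- K^2 / 64).  For 0 <= b the estimate would therefore give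
    L^(2 n + 4) <= C (L K)^(4 s + 16 b) <= C (L K)^(2 n - 4 + 16 b), which fails
    for L = K^m with m large and K large because 16 b < 8.  For b < 0 the weights
    compare with those of b = 0, so [Num.max b 0] replaces b throughout. *)

(** * Derivatives and one-dimensional Gaussian integrals *)

(** The packets are parabolic rescalings by L of one fixed profile, K being the distance from the
    origin in units of the width. Each squared L^2 mass on the Fourier side is a constant times
    L^(-(n + 2)); three such factors against one leave L^(2 n + 4). At s = n / 2 - 1 the weights
    balance this exactly when b = 1/2, so the gap 8 - 16 b is all that drives the contradiction. For
    s < 0 the inhomogeneous weight is much larger near frequency 0 than on the bulk, and the tail
    there must stay below (L K)^(2 s). Hence K has to grow with L, but slowly: with L a high power
    of K, the powers of K lost in crude weight bounds are harmless. The other obstacle is that the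
    norm is an iterated integral while the weight mixes all coordinates. From above the weight is
    dominated by a product of growing Gaussians, which the decay of the packet absorbs; from below
    it is replaced by a constant on a box. Both keep the integrand a product of one-variable
    functions. Working with explicit Gaussians also avoids any convolution: the cube is computed
    pointwise, then transformed by the formula already proved. *)

Section directional_derivative.
Context {R : realType} {V : normedModType R}.
Implicit Types (f g : V -> R) (x v : V).

(** Restricting to a line makes the one-variable chain rule available for directional
    derivatives. *)
Lemma is_derive_line f x v df :
  is_derive x v f df <-> is_derive (0 : R) 1 (fun h : R => f (h *: v + x)) df.
Proof.
have E : (fun h : R => h^-1 *: ((f \o shift x) (h *: v) - f x)) =
    (fun h : R => h^-1 *: (((fun h : R => f (h *: v + x)) \o shift 0) (h *: 1)
       - (fun h : R => f (h *: v + x)) 0)).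
  apply/funext => h /=; congr (_ *: (f _ - f _)).
    by rewrite addr0 -[h *: 1]/(h * 1) mulr1.
  by rewrite scale0r add0r.
split=> -[D1 D2]; split.
- by rewrite /derivable -E.
- by rewrite /derive -E.
- by rewrite /derivable E.
- by rewrite /derive E.
Qed.

Lemma is_derive_add f g x v df dg : is_derive x v f df -> is_derive x v g dg ->
  is_derive x v (fun y => f y + g y) (df + dg).
Proof. exact: is_deriveD. Qed.

Lemma is_derive_mul f g x v df dg : is_derive x v f df -> is_derive x v g dg ->
  is_derive x v (fun y => f y * g y) (f x * dg + g x * df).
Proof. exact: is_deriveM. Qed.

Lemma is_derive_compR (h : R -> R) f x v dh df : is_derive (f x) 1 h dh ->
  is_derive x v f df -> is_derive x v (fun y => h (f y)) (dh * df).
Proof.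
move=> Hh /is_derive_line Hf; apply/is_derive_line.
apply: (@is_derive1_comp _ h (fun t : R => f (t *: v + x))) => //.
by rewrite scale0r add0r.
Qed.

End directional_derivative.

Section gaussian.
Context {R : realType}.
Implicit Types a w x t : R.
Notation mu := (@lebesgue_measure R).

Lemma normal_fun_gaussian a m x : 0 < a ->
  expR (- (a * (x - m) ^+ 2)) = normal_fun m (Num.sqrt (2 * a)^-1) x.
Proof.
move=> a0; rewrite /normal_fun sqr_sqrtr ?invr_ge0 ?mulr_ge0// ?ltW//.
congr expR; rewrite -mulr_natr; field; lra.
Qed.

Lemma integral_gaussian a m : 0 < a ->
  (\int[mu]_x (expR (- (a * (x - m) ^+ 2)))%:E = (Num.sqrt (pi / a))%:E)%E.
Proof.
move=> a0; set sg := Num.sqrt (2 * a)^-1.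
have sg0 : sg != 0 by rewrite gt_eqF// sqrtr_gt0 invr_gt0; lra.
transitivity (\int[mu]_x ((Num.sqrt (pi / a))%:E * (normal_pdf m sg x)%:E))%E.
  apply: eq_integral => x _; rewrite normal_pdfE// -EFinM normal_fun_gaussian// mulrA.
  rewrite /normal_peak sqr_sqrtr ?invr_ge0 ?mulr_ge0// ?ltW//.
  rewrite (_ : (2 * a)^-1 * pi *+ 2 = pi / a); last first.
    by rewrite -mulr_natr; field; lra.
  by rewrite divff ?mul1r// gt_eqF// sqrtr_gt0 divr_gt0// pi_gt0.
rewrite integralZl//; last exact: integrable_normal_pdf.
by rewrite integral_normal_pdf mule1.
Qed.

Lemma measurable_gaussian a m :
  measurable_fun setT (fun x => expR (- (a * (x - m) ^+ 2))).
Proof.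
apply: measurableT_comp => //=; apply: measurableT_comp => //=.
apply: measurable_funM => //=; apply: measurable_funX => //=.
exact: measurable_funB.
Qed.

Lemma integrable_gaussian a m : 0 < a ->
  mu.-integrable setT (EFin \o (fun x => expR (- (a * (x - m) ^+ 2)))).
Proof.
move=> a0; apply/integrableP; split.
  by apply/measurable_EFinP; exact: measurable_gaussian.
under eq_integral do rewrite /= ger0_norm ?expR_ge0//.
by rewrite integral_gaussian// ltry.
Qed.

Lemma integrable_le_gaussian a C (f : R -> R) : 0 < a -> continuous f ->
  (forall x, `|f x| <= C * expR (- (a * x ^+ 2))) ->
  mu.-integrable setT (EFin \o f).
Proof.
move=> a0 cf fC.
apply: (@le_integrable _ _ _ mu _ measurableT _ (fun x => (C * expR (- (a * (x - 0) ^+ 2)))%:E)) => //.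
- by apply/measurable_EFinP; exact: continuous_measurable_fun.
- move=> x _ /=; rewrite lee_fin subr0; apply: (le_trans (fC x)).
  exact: ler_norm.
- under eq_fun do rewrite EFinM.
  by apply: integrableZl => //; exact: (integrable_gaussian a 0 a0).
Qed.

Lemma cvg_integral_exhaustion (f : R -> R) :
  mu.-integrable setT (EFin \o f) ->
  (\int[mu]_(x in `[(- n%:R : R)%R, n%:R%R]) (f x)%:E @[n --> \oo]
    --> \int[mu]_x (f x)%:E)%E.
Proof.
move=> fi.
pose F (n : nat) := (EFin \o f) \_ `[- n%:R : R, n%:R].
have mf : measurable_fun setT (EFin \o f) by case/integrableP : fi.
have [|n|||||_ _] := @dominated_convergence _ _ _ mu setT _ F (EFin \o f) (abse \o (EFin \o f)).
- exact: measurableT.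
- by apply/(measurable_restrictT _ _).1 => //; exact: measurable_funTS.
- exact: mf.
- apply: aeW => x _; apply: cvg_near_cst; near=> n.
  rewrite /F patchE ifT//; rewrite inE/= in_itv/= -ler_norml.
  near: n; exact: nbhs_infty_ger.
- exact: integrable_abse.
- apply: aeW => x n _; rewrite /F patchE; case: ifP => //= _.
  by rewrite normr0 lee_fin.
suff -> : (fun n : nat => \int[mu]_(x in `[(- n%:R : R)%R, n%:R%R]) (f x)%:E)%E = (fun n => \int[mu]_x F n x)%E by [].
by apply/funext => n; rewrite integral_mkcond.
Unshelve. all: by end_near. Qed.


Lemma derivable_continuous (f : R -> R) :
  (forall x, exists d, is_derive x 1 f d) -> continuous f.
Proof.
move=> df x; apply: differentiable_continuous; apply/derivable1_diffP.
by have [d fd] := df x; exact: ex_derive.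
Qed.

(** The fundamental theorem of calculus on [[-n, n]] followed by exhaustion, which is why decay of
    [F] along integers is enough. *)
Lemma integral_derivative_eq0 (f F : R -> R) :
  (forall x, is_derive x 1 F (f x)) -> continuous f ->
  mu.-integrable setT (EFin \o f) ->
  F n%:R @[n --> \oo] --> 0 -> F (- n%:R) @[n --> \oo] --> 0 ->
  \int[mu]_x f x = 0.
Proof.
move=> dF cf fi Fp Fm.
have cF : continuous F.
  by apply: derivable_continuous => x; exists (f x).
have := @cvg_integral_exhaustion _ fi.
have E : \forall n \near \oo, (\int[mu]_(x in `[(- n%:R : R)%R, n%:R%R]) (f x)%:E =
    (F n%:R - F (- n%:R))%:E)%E.
  near=> n; rewrite (@continuous_FTC2 _ f F)//.
  - rewrite -subr_gt0 opprK -mulr2n pmulrn_lgt0// ltr0n.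
    by near: n; exact: nbhs_infty_gt.
  - exact: continuous_subspaceT.
  - split.
    + by move=> x _; exact: ex_derive.
    + exact/cvg_at_right_filter/cF.
    + exact/cvg_at_left_filter/cF.
  - by move=> x _; rewrite derive1E; apply: derive_val.
move=> cv; suff : (\int[mu]_x (f x)%:E = 0)%E by rewrite /Rintegral => ->.
apply: (cvg_unique _ cv) => //.
apply: cvg_trans (near_eq_cvg _) _; first by near=> n; rewrite (near E).
apply: cvg_EFin; first by near=> n.
rewrite -[X in _ --> X](subr0 0).
exact: cvgB.
Unshelve. all: by end_near. Qed.


Lemma cvg0_le_gaussian a C (u : nat -> R) : 0 < a ->
  (forall n, `|u n| <= C * expR (- (a * n%:R ^+ 2))) -> u n @[n --> \oo] --> 0.
Proof.
move=> a0 uC.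
have C0 : 0 <= C.
  by have := le_trans (normr_ge0 _) (uC 0%N); rewrite pmulr_lge0// expR_gt0.
apply/norm_cvg0P.
apply: (@squeeze_cvgr _ _ _ _ (fun=> 0) (fun n => C * (2 + a^-1) * harmonic n)).
- near=> n; rewrite normr_ge0 /=; apply: (le_trans (uC n)).
  have ia0 : 0 < a^-1 by rewrite invr_gt0.
  rewrite -mulrA ler_wpM2l// ler_pdivlMr// expRN mulrC ler_pdivrMr ?expR_gt0//.
  (* The product of [2 + a^-1] with 1 + a n^2 contains 2 + n^2, which dominates the n + 1 in the
     denominator of [harmonic n]. *)
  have h : (2 + a^-1) * (1 + a * n%:R ^+ 2) <= (2 + a^-1) * expR (a * n%:R ^+ 2).
    by rewrite ler_wpM2l ?expR_ge1Dx// addr_ge0// ltW.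
  apply: le_trans h.
  have -> : (2 + a^-1) * (1 + a * n%:R ^+ 2) =
    2 + a^-1 + 2 * (a * n%:R ^+ 2) + n%:R ^+ 2 by field; lra.
  have an : 0 <= a * n%:R ^+ 2 by rewrite mulr_ge0 ?sqr_ge0 ?ltW.
  have n2 : n%:R <= 1 + n%:R ^+ 2 :> R.
    by have := sqr_ge0 (n%:R - 1 : R); have : (0 : R) <= n%:R by []; nra.
  rewrite -natr1; lra.
- exact: cvg_cst.
- rewrite -[X in _ --> X](mulr0 (C * (2 + a^-1))); apply: cvgMr.
  exact: cvg_harmonic.
Unshelve. all: by end_near. Qed.

Let is_derive_id1 x : is_derive x 1 (fun y : R => y) 1.
Proof. exact: is_derive_id. Qed.

Let is_derive_cst1 x c : is_derive x (1 : R) (fun=> c) (0 : R).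
Proof. exact: is_derive_cst. Qed.

Lemma is_derive_linear_phase t w x : is_derive x 1 (fun y : R => t + y * w) w.
Proof.
eapply is_derive_eq.
  eapply is_derive_add; first exact: is_derive_cst1.
  by eapply is_derive_mul; [exact: is_derive_id1 | exact: is_derive_cst1].
by rewrite mulr0 mulr1 !add0r.
Qed.

Lemma is_derive_quadratic a c x :
  is_derive x 1 (fun y : R => a * y ^+ 2 + c) (2 * a * x).
Proof.
eapply is_derive_eq.
  eapply is_derive_add; last exact: is_derive_cst1.
  eapply is_derive_mul; first exact: is_derive_cst1.
  by eapply (is_derive_mul (fun y : R => y) (fun y : R => y)); exact: is_derive_id1.
by rewrite /=; ring.
Qed.

Lemma normr_le_expR a x : 0 < a -> `|x| <= (1 + a^-1) * expR (a * x ^+ 2).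
Proof.
move=> a0; have ax0 : 0 <= a * x ^+ 2 by rewrite mulr_ge0 ?sqr_ge0 ?ltW.
have x1 : `|x| <= 1 + x ^+ 2.
  by have := sqr_ge0 (`|x| - 1); rewrite -(real_normK (num_real x)); nra.
apply: (le_trans x1); rewrite mulrDl mul1r lerD//.
  by apply: le_trans (expR_ge1Dx _); rewrite lerDl.
rewrite ler_pdivlMl//; apply: le_trans (expR_ge1Dx _).
by rewrite lerDr.
Qed.

(* [Phi v x = exp (v^2 / 4a - a x^2) cos (t + v x)] satisfies
   [d/dv Phi = d/dx Psi] with [Psi] decaying in x, so its integral in x does not
   depend on v. *)
Lemma integral_gaussian_cos a t w : 0 < a ->
  \int[mu]_x (expR (- (a * x ^+ 2)) * cos (t + x * w)) =
  Num.sqrt (pi / a) * expR (- (w ^+ 2 / (4 * a))) * cos t.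
Proof.
move=> a0.
pose Phi v x := expR ((4 * a)^-1 * v ^+ 2 + - (a * x ^+ 2)) * cos (t + v * x).
pose dPhi v x := expR ((4 * a)^-1 * v ^+ 2 + - (a * x ^+ 2)) *
   ((2 * a)^-1 * v * cos (t + v * x) - x * sin (t + v * x)).
pose Psi v x := (2 * a)^-1 * expR (- a * x ^+ 2 + (4 * a)^-1 * v ^+ 2) *
   sin (t + x * v).
have D1 (v x : R) : is_derive v 1 (Phi^~ x) (dPhi v x).
  eapply is_derive_eq.
    eapply is_derive_mul.
      by eapply is_derive_compR; [exact: is_derive_expR | exact: is_derive_quadratic].
    by eapply is_derive_compR; [exact: is_derive_cos | exact: is_derive_linear_phase].
  rewrite /dPhi; field; lra.
have swap v x : expR ((4 * a)^-1 * v ^+ 2 + - (a * x ^+ 2)) =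
    expR (- a * x ^+ 2 + (4 * a)^-1 * v ^+ 2) by rewrite addrC mulNr.
have D2 (v x : R) : is_derive x 1 (Psi v) (dPhi v x).
  eapply is_derive_eq.
    eapply is_derive_mul.
      eapply is_derive_mul; first exact: is_derive_cst1.
      by eapply is_derive_compR; [exact: is_derive_expR | exact: is_derive_quadratic].
    by eapply is_derive_compR; [exact: is_derive_sin | exact: is_derive_linear_phase].
  rewrite /dPhi swap (mulrC v x); field; lra.
have Phi0 v x : `|Phi v x| <= expR ((4 * a)^-1 * v ^+ 2) * expR (- (a * x ^+ 2)).
  rewrite /Phi normrM ger0_norm ?expR_ge0// expRD ler_piMr// ?cos_max//.
have Psi0 v x : `|Psi v x| <=
    (2 * a)^-1 * expR ((4 * a)^-1 * v ^+ 2) * expR (- (a * x ^+ 2)).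
  rewrite /Psi normrM ger0_norm ?mulr_ge0 ?expR_ge0 ?invr_ge0 ?mulr_ge0 ?(ltW a0)//.
  rewrite mulNr addrC expRD -!mulrA ler_wpM2l ?invr_ge0 ?mulr_ge0 ?(ltW a0)//.
  by rewrite mulrA ler_piMr// ?sin_max.
(* [Cb W] serves all [v] with |v| <= W at once: half of the rate [a] is spent on the factor [x] of
   [dPhi], and the remaining rate [a / 2] gives a dominating function independent of [v]. *)
pose Cb W := expR ((4 * a)^-1 * W ^+ 2) * ((2 * a)^-1 * W + (1 + (a / 2)^-1)).
have a20 : 0 < a / 2 by rewrite divr_gt0.
have dPhi0 (W v x : R) : `|v| <= W -> `|dPhi v x| <= Cb W * expR (- (a / 2 * x ^+ 2)).
  move=> vW; have W0 : 0 <= W by exact: le_trans vW.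
  rewrite /dPhi /Cb normrM ger0_norm ?expR_ge0// expRD -[leLHS]mulrA -[leRHS]mulrA.
  apply: ler_pM; rewrite ?expR_ge0 ?mulr_ge0 ?expR_ge0//.
    rewrite ler_expR ler_wpM2l ?invr_ge0 ?mulr_ge0 ?(ltW a0)//.
    by rewrite -(real_normK (num_real v)) ler_sqr ?nnegrE.
  have -> : expR (- (a * x ^+ 2)) =
      expR (- (a / 2 * x ^+ 2)) * expR (- (a / 2 * x ^+ 2)).
    by rewrite -expRD; congr expR; lra.
  rewrite -[leLHS]mulrA [leRHS]mulrC ler_wpM2l ?expR_ge0//.
  rewrite expRN mulrC ler_pdivrMr ?expR_gt0//.
  apply: (le_trans (ler_normB _ _)); rewrite [leRHS]mulrDl.
  apply: lerD.
    rewrite -mulrA normrM ger0_norm ?invr_ge0 ?mulr_ge0 ?(ltW a0)//.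
    rewrite -[leRHS]mulrA ler_wpM2l ?invr_ge0 ?mulr_ge0 ?(ltW a0)//.
    rewrite normrM; apply: ler_pM => //.
    apply: (le_trans (cos_max _)); rewrite -[leLHS]expR0 ler_expR.
    by rewrite mulr_ge0 ?sqr_ge0 ?(ltW a20).
  rewrite normrM; apply: le_trans (normr_le_expR _ _ a20).
  by rewrite ler_piMr// sin_max.
have cPhi v : continuous (Phi v).
  have -> : Phi v = fun x =>
      expR (- a * x ^+ 2 + (4 * a)^-1 * v ^+ 2) * cos (t + x * v).
    by apply/funext => x; rewrite /Phi swap (mulrC v).
  apply: derivable_continuous => x; eexists; eapply is_derive_mul.
    by eapply is_derive_compR; [exact: is_derive_expR | exact: is_derive_quadratic].
  by eapply is_derive_compR; [exact: is_derive_cos | exact: is_derive_linear_phase].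
have cdPhi v : continuous (dPhi v).
  have -> : dPhi v = fun x =>
      expR (- a * x ^+ 2 + (4 * a)^-1 * v ^+ 2) *
      ((2 * a)^-1 * v * cos (t + x * v) + - x * sin (t + x * v)).
    by apply/funext => x; rewrite /dPhi swap (mulrC v x) (mulNr x).
  apply: derivable_continuous => x; eexists; eapply is_derive_mul.
    by eapply is_derive_compR; [exact: is_derive_expR | exact: is_derive_quadratic].
  eapply is_derive_add; eapply is_derive_mul.
  - exact: is_derive_cst1.
  - by eapply is_derive_compR; [exact: is_derive_cos | exact: is_derive_linear_phase].
  - exact: is_deriveNid.
  - by eapply is_derive_compR; [exact: is_derive_sin | exact: is_derive_linear_phase].
have iPhi v : mu.-integrable setT (EFin \o Phi v).
  by apply: (integrable_le_gaussian a _ _ a0); [exact: cPhi|exact: Phi0].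
have idPhi v : mu.-integrable setT (EFin \o dPhi v).
  apply: (integrable_le_gaussian (a / 2) (Cb `|v|) _ a20); first exact: cdPhi.
  by move=> x; exact: dPhi0.
have int0 v : \int[mu]_x dPhi v x = 0.
  apply: (integral_derivative_eq0 _ (Psi v)) => //.
  - by apply: (cvg0_le_gaussian a _ _ a0) => n; exact: Psi0.
  - apply: (cvg0_le_gaussian a _ _ a0) => n; apply: (le_trans (Psi0 _ _)).
    by rewrite sqrrN.
have pPhi v x : partial1of2 Phi v x = dPhi v x.
  by rewrite partial1of2E; exact: derive_val.
have DI (v : R) : is_derive v 1 (fun v => \int[mu]_x Phi v x) 0.
  have vI : `](v - 1), (v + 1)[%classic v by rewrite /= in_itv/= ltrBlDr ltrDl ltr01.
  have b1 y x : `](v - 1), (v + 1)[%classic y -> setT x ->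
      `|partial1of2 Phi y x| <= Cb (`|v| + 1) * expR (- (a / 2 * x ^+ 2)).
    rewrite /= in_itv/= => /andP[y1 y2] _; rewrite pPhi; apply: dPhi0.
    rewrite -lerBlDl; apply: le_trans (lerB_dist _ _) _.
    by rewrite ler_norml; apply/andP; split; lra.
  have Cb0 : 0 <= Cb (`|v| + 1).
    rewrite mulr_ge0 ?expR_ge0// addr_ge0// ?mulr_ge0 ?addr_ge0 ?invr_ge0//.
    by rewrite mulr_ge0// ltW.
    exact: ltW.
  have G0 (x : R) : 0 <= Cb (`|v| + 1) * expR (- (a / 2 * x ^+ 2)).
    by rewrite mulr_ge0// expR_ge0.
  have iG : mu.-integrable setT
      (EFin \o (fun x => Cb (`|v| + 1) * expR (- (a / 2 * x ^+ 2)))).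
    apply: (integrable_le_gaussian (a / 2) (Cb (`|v| + 1)) _ a20).
      apply: derivable_continuous => x; eexists; eapply is_derive_mul.
        exact: is_derive_cst1.
      eapply (is_derive_compR expR); first exact: is_derive_expR.
      have -> : (fun y : R => - (a / 2 * y ^+ 2)) = (fun y => - (a / 2) * y ^+ 2 + 0).
        by apply/funext => y; rewrite addr0 mulNr.
      exact: is_derive_quadratic.
    by move=> x; rewrite ger0_norm.
  have dP y x : `](v - 1), (v + 1)[%classic y -> setT x -> derivable (Phi^~ x) y 1.
    by move=> _ _; exact: ex_derive.
  split.
    exact: (derivable_under_integral measurableT vI (fun v _ => iPhi v) dP G0 iG b1).
  rewrite -derive1E.
  rewrite (differentiation_under_integral measurableT vI (fun v _ => iPhi v) dP G0 iG b1).
  by rewrite -[RHS](int0 v); apply: eq_Rintegral => x _; exact: pPhi.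
have E v x : expR (- (v ^+ 2 / (4 * a))) * Phi v x =
    expR (- (a * x ^+ 2)) * cos (t + x * v).
  rewrite /Phi mulrA -expRD (mulrC v x) (mulrC (v ^+ 2)).
  by rewrite addrA addNr add0r.
(* Constancy in [v] moves the integral from [v = w] to [v = 0], where the cosine is the constant
   [cos t] and a plain Gaussian integral remains. *)
have cst := @is_derive_0_is_cst _ _ w 0 DI.
under eq_Rintegral do rewrite -E.
rewrite (RintegralZl _ measurableT (iPhi w)) cst mulrC [RHS]mulrAC.
congr (_ * _).
under eq_Rintegral => x _.
  rewrite /Phi expr0n/= mulr0 add0r mul0r addr0.
  over.
rewrite RintegralZr//; last first.
  by have := integrable_gaussian a 0 a0; under eq_fun do rewrite subr0.
rewrite /Rintegral; under eq_integral => x _ do rewrite -[x in a * x ^+ 2]subr0.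
by rewrite integral_gaussian.
Qed.

Lemma integrable_gaussian_cos a t w : 0 < a ->
  mu.-integrable setT (EFin \o (fun x => expR (- (a * x ^+ 2)) * cos (t + x * w))).
Proof.
move=> a0; apply: (integrable_le_gaussian a 1 _ a0).
  have -> : (fun x : R => expR (- (a * x ^+ 2)) * cos (t + x * w)) =
      (fun x => expR (- a * x ^+ 2 + 0) * cos (t + x * w)).
    by apply/funext => x; rewrite mulNr addr0.
  apply: derivable_continuous => x; eexists; eapply is_derive_mul.
    by eapply is_derive_compR; [exact: is_derive_expR | exact: is_derive_quadratic].
  by eapply is_derive_compR; [exact: is_derive_cos | exact: is_derive_linear_phase].
move=> x; rewrite normrM ger0_norm ?expR_ge0// mul1r.
by rewrite ler_piMr ?expR_ge0 ?cos_max.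
Qed.

End gaussian.

(** * Gaussians are Schwartz functions *)

(** One term of the exponential series at [al * (1 + E)] suffices. It has degree k + 1, which 1 + E
    >= 1 allows, and the factor [expR al] in the constant pays for the shift of [E] by 1. *)
Lemma exprn_le_expR (R : realType) (k : nat) (al : R) : 0 < al ->
  exists2 M : R, 0 <= M & forall E : R, 0 <= E -> (1 + E) ^+ k <= M * expR (al * E).
Proof.
move=> al0; exists (k.+1`!%:R / al ^+ k.+1 * expR al).
  by rewrite mulr_ge0 ?expR_ge0// divr_ge0// exprn_ge0// ltW.
move=> E E0; rewrite -[leRHS]mulrA -expRD.
have E1 : 1 <= 1 + E by rewrite lerDl.
have E10 : 0 <= 1 + E by exact: le_trans E1.
rewrite (_ : al + _ = al * (1 + E)); last by ring.
apply: (@le_trans _ _ ((1 + E) ^+ k.+1)); first by rewrite ler_weXn2l.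
have h := expR_ge1Dxn k (mulr_ge0 (ltW al0) E10).
rewrite mulrAC ler_pdivlMr ?exprn_gt0// -exprMn.
rewrite -ler_pdivrMl ?ltr0n ?fact_gt0//.
by apply: le_trans h; rewrite (mulrC al) [leLHS]mulrC lerDr.
Qed.

Section schwartz_gaussian.
Context {R : realType} (N : nat).
Implicit Types (P Q : 'rV[R]_N -> R) (z v x : 'rV[R]_N).

(** Polynomials in the coordinates, given by closure rules so that stability under derivatives and
    polynomial growth follow by induction. *)
Inductive polyfun : ('rV[R]_N -> R) -> Prop :=
| polyfun_cst c : polyfun (fun=> c)
| polyfun_coord i : polyfun (fun z => z 0 i)
| polyfun_add P Q : polyfun P -> polyfun Q -> polyfun (fun z => P z + Q z)
| polyfun_mul P Q : polyfun P -> polyfun Q -> polyfun (fun z => P z * Q z).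

Lemma polyfun_sum n (F : 'I_n -> 'rV[R]_N -> R) : (forall i, polyfun (F i)) ->
  polyfun (fun z => \sum_(i < n) F i z).
Proof.
elim: n F => [|n IH] F HF.
  by under eq_fun do rewrite big_ord0; exact: polyfun_cst.
under eq_fun do rewrite big_ord_recr /=.
by apply: polyfun_add => //; apply: (IH (fun i => F (widen_ord (leqnSn n) i))).
Qed.

Lemma polyfun_derive P v : polyfun P ->
  exists2 D, polyfun D & forall x, is_derive x v P (D x).
Proof.
elim=> [c|i|{}P Q pP [DP pDP dP] pQ [DQ pDQ dQ]|{}P Q pP [DP pDP dP] pQ [DQ pDQ dQ]].
- by exists (fun=> 0); [exact: polyfun_cst | move=> x; exact: is_derive_cst].
- exists (fun=> v 0 i); [exact: polyfun_cst | move=> x; apply/is_derive_line].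
  have -> : (fun h : R => (h *: v + x) 0 i) = (fun h => x 0 i + h * v 0 i).
    by apply/funext => h; rewrite !mxE addrC.
  exact: is_derive_linear_phase.
- exists (fun z => DP z + DQ z); first exact: polyfun_add.
  by move=> x; exact: is_derive_add.
- exists (fun z => P z * DQ z + Q z * DP z).
    by apply: polyfun_add; exact: polyfun_mul.
  by move=> x; exact: is_derive_mul.
Qed.

Lemma dotR_ge0 z : 0 <= dotR z z.
Proof. by apply: sumr_ge0 => i _; rewrite -expr2 sqr_ge0. Qed.

Lemma sqr_coord_le_dotR z i : z 0 i ^+ 2 <= dotR z z.
Proof.
rewrite /dotR (bigD1 i)//= expr2 lerDl.
by apply: sumr_ge0 => j _; rewrite -expr2 sqr_ge0.
Qed.

Lemma polyfun_growth P : polyfun P ->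
  exists k C, 0 <= C /\ forall x, `|P x| <= C * (1 + dotR x x) ^+ k.
Proof.
have d1 x : 1 <= 1 + dotR x x by rewrite lerDl dotR_ge0.
have d0 x : 0 <= 1 + dotR x x by exact: le_trans (d1 x).
elim=> [c|i|{}P Q _ [k [C [C0 kC]]] _ [l [D [D0 lD]]]
           |{}P Q _ [k [C [C0 kC]]] _ [l [D [D0 lD]]]].
- by exists 0%N, `|c|; split=> // x; rewrite expr0 mulr1.
- exists 1%N, 1; split=> // x; rewrite mul1r expr1.
  have := sqr_coord_le_dotR x i; rewrite -(real_normK (num_real (x 0 i))).
  by have := sqr_ge0 (`|x 0 i| - 1); nra.
- exists (k + l)%N, (C + D); split; first exact: addr_ge0.
  move=> x; apply: (le_trans (ler_normD _ _)); rewrite mulrDl.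
  apply: lerD; [apply: le_trans (kC x) _|apply: le_trans (lD x) _].
    by rewrite ler_wpM2l// ler_weXn2l// leq_addr.
  by rewrite ler_wpM2l// ler_weXn2l// leq_addl.
- exists (k + l)%N, (C * D); split; first exact: mulr_ge0.
  by move=> x; rewrite normrM exprD mulrACA ler_pM.
Qed.

Lemma enorm_le z : 1 + enorm z <= 2 * (1 + dotR z z).
Proof.
have h := dotR_ge0 z; have := sqr_sqrtr h; rewrite /enorm.
have := sqrtr_ge0 (dotR z z); set r := Num.sqrt _ => r0 <-.
by have := sqr_ge0 (r - 1); nra.
Qed.

(** Functions of this shape are closed under directional derivatives, only the polynomial
    coefficients changing. Every iterated derivative is thus polynomial times Gaussian, and the
    lower bound on [q] beats any power. *)
Lemma schwartzR_gaussian (al : R) q p P Q : 0 < al -> polyfun q -> polyfun p ->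
  (forall z, al * dotR z z <= q z) -> polyfun P -> polyfun Q ->
  schwartzR (fun z => P z * (expR (- q z) * cos (p z))
                    + Q z * (expR (- q z) * sin (p z))).
Proof.
move=> al0 pq pp qal pP pQ vs.
have dstep v P' Q' : polyfun P' -> polyfun Q' -> exists P'' Q'',
  [/\ polyfun P'', polyfun Q'' & forall x, is_derive x v
   (fun z => P' z * (expR (- q z) * cos (p z)) + Q' z * (expR (- q z) * sin (p z)))
   (P'' x * (expR (- q x) * cos (p x)) + Q'' x * (expR (- q x) * sin (p x)))].
  move=> pP' pQ'.
  have [Dq pDq dq] := polyfun_derive _ v pq.
  have [Dp pDp dp] := polyfun_derive _ v pp.
  have [DP pDP dP] := polyfun_derive _ v pP'.
  have [DQ pDQ dQ] := polyfun_derive _ v pQ'.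
  (* [polyfun] has no rule for opposites, so signs enter as multiplication by this constant
     polynomial. *)
  pose m z : R := -1.
  have pm : polyfun m by exact: polyfun_cst.
  exists (fun z => DP z + (m z * Dq z * P' z + Dp z * Q' z)),
    (fun z => DQ z + (m z * Dq z * Q' z + m z * Dp z * P' z)); split.
  - by do ?[apply: polyfun_add|apply: polyfun_mul].
  - by do ?[apply: polyfun_add|apply: polyfun_mul].
  move=> x.
  have de : is_derive x v (fun z => expR (- q z)) (expR (- q x) * - Dq x).
    eapply is_derive_compR; first exact: is_derive_expR.
    exact: is_deriveN.
  have dc : is_derive x v (fun z => cos (p z)) (- sin (p x) * Dp x).
    by eapply is_derive_compR; [exact: is_derive_cos|].
  have ds : is_derive x v (fun z => sin (p z)) (cos (p x) * Dp x).
    by eapply is_derive_compR; [exact: is_derive_sin|].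
  have dC := is_derive_mul _ _ _ _ _ _ de dc.
  have dS := is_derive_mul _ _ _ _ _ _ de ds.
  apply: (is_derive_eq (is_derive_add _ _ _ _ _ _
    (is_derive_mul _ _ _ _ _ _ (dP x) dC) (is_derive_mul _ _ _ _ _ _ (dQ x) dS))).
  by rewrite /m; ring.
have [P' [Q' [pP' pQ' ->]]] : exists P' Q', [/\ polyfun P', polyfun Q' &
   iderive vs (fun z => P z * (expR (- q z) * cos (p z))
                    + Q z * (expR (- q z) * sin (p z))) =
   (fun z => P' z * (expR (- q z) * cos (p z))
                    + Q' z * (expR (- q z) * sin (p z)))].
  elim: vs => [|v vs [P' [Q' [pP' pQ' E]]]]; first by exists P, Q.
  have [P'' [Q'' [pP'' pQ'' D]]] := dstep v _ _ pP' pQ'.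
  exists P'', Q''; split=> //=; apply/funext => x; rewrite E.
  exact: derive_val.
split.
  move=> v x; have [P'' [Q'' [pP'' pQ'' D]]] := dstep v _ _ pP' pQ'.
  exact: ex_derive.
move=> k.
have [kP [C [C0 PC]]] := polyfun_growth _ pP'.
have [kQ [D [D0 QD]]] := polyfun_growth _ pQ'.
have [M M0 HM] := exprn_le_expR R (k + (kP + kQ)) al al0.
exists (2 ^+ k * ((C + D) * M)) => x.
have d0 := dotR_ge0 x.
have d1 : 1 <= 1 + dotR x x by rewrite lerDl.
have d2 : 0 <= 1 + dotR x x by exact: le_trans d1.
have e0 : 0 <= 1 + enorm x by rewrite addr_ge0// sqrtr_ge0.
have H1 : (1 + enorm x) ^+ k <= 2 ^+ k * (1 + dotR x x) ^+ k.
  by rewrite -exprMn lerXn2r ?nnegrE ?mulr_ge0// enorm_le.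
have H2 : `|P' x * (expR (- q x) * cos (p x)) + Q' x * (expR (- q x) * sin (p x))|
    <= (C + D) * (1 + dotR x x) ^+ (kP + kQ) * expR (- (al * dotR x x)).
  apply: (le_trans (ler_normD _ _)).
  have e1 : expR (- q x) <= expR (- (al * dotR x x)) by rewrite ler_expR lerN2.
  have e2 (t r B : R) : `|t| <= B -> `|r| <= 1 ->
      `|t * (expR (- q x) * r)| <= B * expR (- (al * dotR x x)).
    move=> tB r1; rewrite normrM ler_pM// normrM ger0_norm ?expR_ge0//.
    by apply: le_trans e1; rewrite ler_piMr ?expR_ge0.
  rewrite mulrDl mulrDl; apply: lerD.
    apply: e2; last exact: cos_max.
    apply: le_trans (PC x) _.
    by rewrite ler_wpM2l// ler_weXn2l// leq_addr.
  apply: e2; last exact: sin_max.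
  apply: le_trans (QD x) _.
  by rewrite ler_wpM2l// ler_weXn2l// leq_addl.
apply: le_trans (ler_pM _ _ H1 H2) _; rewrite ?exprn_ge0//.
rewrite -!mulrA ler_wpM2l ?exprn_ge0//.
have -> (y y' c e : R) : y * (c * (y' * e)) = c * ((y * y') * e) by ring.
rewrite ler_wpM2l ?addr_ge0// -exprD expRN ler_pdivrMr ?expR_gt0//.
exact: HM.
Qed.

End schwartz_gaussian.

(** * Iterated integrals and Fourier transforms of wave packets *)

Section iterated_integrals.
Context {R : realType}.
Notation mu := (@lebesgue_measure R).

(* Unlike [ge0_le_integral], no measurability is required: the integral of a
   nonnegative function is a supremum over simple functions below it. *)
Lemma ge0_le_integral_nonmeasurable (f g : R -> \bar R) :
  (forall x, 0 <= f x)%E -> (forall x, f x <= g x)%E ->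
  (\int[mu]_x f x <= \int[mu]_x g x)%E.
Proof.
move=> f0 fg; have g0 x : (0 <= g x)%E by exact: le_trans (fg x).
rewrite !ge0_integralTE//; apply: ereal_sup_le => _ [h hf <-].
by exists h => // x; exact: le_trans (hf x) (fg x).
Qed.

Lemma iintE_ge0 N (F : 'rV[R]_N -> \bar R) :
  (forall z, 0 <= F z)%E -> (0 <= iintE F)%E.
Proof.
elim: N F => [|N IH] F F0 //=; apply: integral_ge0 => x _.
by apply: IH => v; exact: F0.
Qed.

Lemma le_iintE N (F G : 'rV[R]_N -> \bar R) :
  (forall z, 0 <= F z)%E -> (forall z, F z <= G z)%E -> (iintE F <= iintE G)%E.
Proof.
elim: N F G => [|N IH] F G F0 FG //=.
apply: ge0_le_integral_nonmeasurable => x.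
  by apply: iintE_ge0 => v; exact: F0.
by apply: IH => v; [exact: F0|exact: FG].
Qed.

Lemma row_mx_head N x (v : 'rV[R]_N) :
  (row_mx (\row_(j < 1) x) v : 'rV[R]_N.+1) 0 ord0 = x.
Proof.
transitivity ((row_mx (\row_(j < 1) x) v) 0 (lshift N (ord0 : 'I_1))).
  by congr (fun_of_matrix _ _ _); exact: val_inj.
by rewrite row_mxEl mxE.
Qed.

Lemma row_mx_tail N x (v : 'rV[R]_N) i :
  (row_mx (\row_(j < 1) x) v : 'rV[R]_N.+1) 0 (lift ord0 i) = v 0 i.
Proof.
transitivity ((row_mx (\row_(j < 1) x) v) 0 (rshift 1 i)).
  by congr (fun_of_matrix _ _ _); exact: val_inj.
by rewrite row_mxEr.
Qed.

(** The constant [k] collects the factors of the coordinates already fixed, which makes the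
    induction on the number of variables go through. *)
Lemma iintE_prod N (k : R) (f : 'I_N -> R -> R) (I : 'I_N -> R) : 0 <= k ->
  (forall i x, 0 <= f i x) -> (forall i, measurable_fun setT (f i)) ->
  (forall i, \int[mu]_x (f i x)%:E = (I i)%:E)%E ->
  iintE (fun z => (k * \prod_i f i (z 0 i))%:E) = (k * \prod_i I i)%:E.
Proof.
elim: N k f I => [|N IH] k f I k0 f0 mf If /=; first by rewrite !big_ord0.
have I0 i : 0 <= I i.
  by rewrite -lee_fin -If; apply: integral_ge0 => x _; rewrite lee_fin.
transitivity (\int[mu]_x
   ((k * \prod_i I (lift ord0 i))%:E * (f ord0 x)%:E))%E.
  apply: eq_integral => x _.
  rewrite -EFinM mulrAC -(IH _ (fun i => f (lift ord0 i))) ?mulr_ge0//.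
  congr iintE; apply/funext => v; rewrite big_ord_recl row_mx_head mulrA.
  by congr (_ * _)%:E; apply: eq_bigr => i _; rewrite row_mx_tail.
rewrite ge0_integralZl_EFin//; last 3 first.
- by move=> x _; rewrite lee_fin.
- by apply/measurable_EFinP; exact: mf.
- by rewrite mulr_ge0// prodr_ge0.
by rewrite If -EFinM big_ord_recl mulrAC mulrA.
Qed.

(** The free phase [t] absorbs the contribution of the first coordinate in the induction. Taking t =
    pi / 2 later turns the cosine into a sine, so this one formula also shows that the imaginary
    part of the transform vanishes. *)
Lemma iintR_gaussian_cos N (a : 'I_N -> R) (k t : R) (w : 'rV[R]_N) :
  (forall i, 0 < a i) ->
  iintR (fun z => k * (expR (- \sum_i a i * z 0 i ^+ 2) * cos (t + dotR z w))) =
  k * (\prod_i (Num.sqrt (pi / a i) * expR (- (w 0 i ^+ 2 / (4 * a i)))) * cos t).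
Proof.
elim: N a k t w => [|N IH] a k t w a0 /=.
  by rewrite /dotR !big_ord0 oppr0 expR0 addr0.
pose w' := \row_(i < N) w 0 (lift ord0 i).
pose B := \prod_(i < N) (Num.sqrt (pi / a (lift ord0 i)) *
   expR (- (w 0 (lift ord0 i) ^+ 2 / (4 * a (lift ord0 i))))).
transitivity (\int[mu]_x ((k * B) *
   (expR (- (a ord0 * x ^+ 2)) * cos (t + x * w 0 ord0)))).
  apply: eq_Rintegral => x _.
  transitivity (iintR (fun v => (k * expR (- (a ord0 * x ^+ 2))) *
     (expR (- \sum_i a (lift ord0 i) * v 0 i ^+ 2) *
      cos ((t + x * w 0 ord0) + dotR v w')))).
    congr iintR; apply/funext => v; rewrite -[RHS]mulrA; congr (_ * _).
    rewrite [RHS]mulrA; congr (_ * cos _).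
      rewrite -expRD big_ord_recl row_mx_head opprD; congr expR.
      congr (_ - _).
      by apply: eq_bigr => i _; rewrite row_mx_tail.
    rewrite /dotR big_ord_recl row_mx_head -addrA; congr (_ + (_ + _)).
    by apply: eq_bigr => i _; rewrite row_mx_tail !mxE.
  rewrite (IH (fun i => a (lift ord0 i)))//.
  rewrite (_ : \prod_i _ = B); first by ring.
  by apply: eq_bigr => i _; rewrite mxE.
rewrite RintegralZl//; last exact: integrable_gaussian_cos.
by rewrite integral_gaussian_cos// big_ord_recl -/B; ring.
Qed.

End iterated_integrals.

(** * Wave packets: cube, Fourier transform, Schwartz class *)

Section wave_packet.
Context {R : realType} {N : nat}.
Implicit Types (a : 'I_N -> R) (k w z : 'rV[R]_N).
Local Open Scope complex_scope.

(** This is exp (- sum a_i z_i^2 + i z.k), split into real and imaginary parts. Its Fourier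
    transform is a real Gaussian centred at [k] whose width in coordinate i is of order sqrt
    (a_i). *)
Definition wave_packet a k z : R[i] :=
  (expR (- \sum_i a i * z 0 i ^+ 2) * cos (dotR z k)) +i*
  (expR (- \sum_i a i * z 0 i ^+ 2) * sin (dotR z k)).

(** The oscillating factor has modulus 1, so f times its conjugate loses the phase and the last
    factor restores it: the centre [k] is kept while the Gaussian rates triple. *)
Lemma wave_packet_cube a k z :
  wave_packet a k z * (wave_packet a k z)^* * wave_packet a k z =
  wave_packet (fun i => 3 * a i) k z.
Proof.
rewrite /wave_packet; set S := \sum_i a i * _.
have -> : \sum_i 3 * a i * z 0 i ^+ 2 = 3 * S.
  by rewrite mulr_sumr; apply: eq_bigr => i _; rewrite mulrA.
have -> : expR (- (3 * S)) = expR (- S) ^+ 3.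
  by rewrite -expRM_natl mulrN.
have := cos2Dsin2 (dotR z k); set c := cos _; set s := sin _; set e := expR _.
move=> cs; apply/eqP; rewrite eq_complex /=; apply/andP; split; apply/eqP.
  by rewrite -[e ^+ 3 * c]mulr1 -cs; ring.
by rewrite -[e ^+ 3 * s]mulr1 -cs; ring.
Qed.

Lemma dotRBr z w k : dotR z (w - k) = dotR z w - dotR z k.
Proof. by rewrite /dotR -sumrB; apply: eq_bigr => i _; rewrite !mxE mulrBr. Qed.

Lemma fourierRe_wave_packet a k w : (forall i, 0 < a i) ->
  fourierRe (wave_packet a k) w =
  \prod_i (Num.sqrt (pi / a i) * expR (- ((w 0 i - k 0 i) ^+ 2 / (4 * a i)))).
Proof.
move=> a0; rewrite /fourierRe.
transitivity (iintR (fun z : 'rV[R]_N => 1 *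
   (expR (- \sum_i a i * z 0 i ^+ 2) * cos (0 + dotR z (w - k))))).
  by congr iintR; apply/funext => z /=; rewrite add0r dotRBr cosB; ring.
rewrite iintR_gaussian_cos// cos0 mulr1 mul1r.
by apply: eq_bigr => i _; rewrite !mxE.
Qed.

Lemma fourierIm_wave_packet a k w : (forall i, 0 < a i) ->
  fourierIm (wave_packet a k) w = 0.
Proof.
move=> a0; rewrite /fourierIm.
transitivity (iintR (fun z : 'rV[R]_N => 1 *
   (expR (- \sum_i a i * z 0 i ^+ 2) * cos (pi / 2 + dotR z (w - k))))).
  congr iintR; apply/funext => z /=.
  by rewrite dotRBr (addrC (pi / 2)) cosDpihalf sinB; ring.
by rewrite iintR_gaussian_cos// cos_pihalf !mulr0.
Qed.

Lemma schwartz_wave_packet a k : (forall i, 0 < a i) -> schwartz (wave_packet a k).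
Proof.
move=> a0.
have [al al0 aal] : exists2 al : R, 0 < al & forall i, al <= a i.
  (* The default value 1 keeps the minimum positive when there are no coordinates. *)
  exists (\big[Num.min/1]_i a i).
    by elim/big_ind: _ => // x y x0 y0; rewrite lt_min x0.
  by move=> i; exact: bigmin_le.
have pq : polyfun N (fun z : 'rV[R]_N => \sum_i a i * z 0 i ^+ 2).
  apply: polyfun_sum => i; apply: polyfun_mul; first exact: polyfun_cst.
  by apply: (polyfun_mul _ (fun z => z 0 i) (fun z => z 0 i)); exact: polyfun_coord.
have pp : polyfun N (fun z : 'rV[R]_N => dotR z k).
  apply: polyfun_sum => i; apply: polyfun_mul; first exact: polyfun_coord.
  exact: polyfun_cst.
have qal z : al * dotR z z <= \sum_i a i * z 0 i ^+ 2.
  rewrite /dotR mulr_sumr; apply: ler_sum => i _.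
  by rewrite -expr2 ler_wpM2r ?sqr_ge0.
split.
- have -> : (fun z => complex.Re (wave_packet a k z)) = (fun z =>
     1 * (expR (- \sum_i a i * z 0 i ^+ 2) * cos (dotR z k)) +
     0 * (expR (- \sum_i a i * z 0 i ^+ 2) * sin (dotR z k))).
    by apply/funext => z /=; rewrite mul1r mul0r addr0.
  by apply: (schwartzR_gaussian _ al _ _ (fun=> 1) (fun=> 0)) => //; exact: polyfun_cst.
- have -> : (fun z => complex.Im (wave_packet a k z)) = (fun z =>
     0 * (expR (- \sum_i a i * z 0 i ^+ 2) * cos (dotR z k)) +
     1 * (expR (- \sum_i a i * z 0 i ^+ 2) * sin (dotR z k))).
    by apply/funext => z /=; rewrite mul1r mul0r add0r.
  by apply: (schwartzR_gaussian _ al _ _ (fun=> 0) (fun=> 1)) => //; exact: polyfun_cst.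
Qed.

End wave_packet.

(** * Norms of wave packets *)

Section wave_packet_norm.
Context {R : realType} {n : nat}.
Notation mu := (@lebesgue_measure R).
Implicit Types (a r th : 'I_n.+1 -> R) (k w : 'rV[R]_n.+1) (s b A B : R).

Lemma Xweight_ge0 s b w : 0 <= Xweight s b w.
Proof. by rewrite mulr_ge0 ?powR_ge0. Qed.

Lemma XnormSq_wave_packet s b a k : (forall i, 0 < a i) ->
  XnormSq s b (wave_packet a k) = iintE (fun w => (Xweight s b w *
    \prod_i (pi / a i * expR (- ((w 0 i - k 0 i) ^+ 2 / (2 * a i)))))%:E).
Proof.
move=> a0; congr iintE; apply/funext => w.
rewrite fourierIm_wave_packet// fourierRe_wave_packet// expr0n addr0 -prodrXl.
congr (_ * _)%:E; apply: eq_bigr => i _.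
rewrite exprMn sqr_sqrtr ?divr_ge0 ?pi_ge0 ?(ltW (a0 i))//; congr (_ * _).
rewrite expr2 -expRD; congr expR; have := a0 i => ai; field; lra.
Qed.

(** The majorant of the weight factors over the coordinates, and [th i] below the rate of the
    squared transform leaves a convergent Gaussian integral in each variable. *)
Lemma XnormSq_wave_packet_le s b a k A th : (forall i, 0 < a i) -> 0 <= A ->
  (forall i, th i < (2 * a i)^-1) ->
  (forall w, Xweight s b w <= A * expR (\sum_i th i * (w 0 i - k 0 i) ^+ 2)) ->
  (XnormSq s b (wave_packet a k) <=
   (A * \prod_i (pi / a i * Num.sqrt (pi / ((2 * a i)^-1 - th i))))%:E)%E.
Proof.
move=> a0 A0 tha Xle; rewrite XnormSq_wave_packet//.
pose f i x := pi / a i * expR (- (((2 * a i)^-1 - th i) * (x - k 0 i) ^+ 2)).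
have pia i : 0 <= pi / a i by rewrite divr_ge0 ?pi_ge0 ?ltW.
rewrite -(@iintE_prod _ _ _ f)//; last 3 first.
- by move=> i x; rewrite mulr_ge0// expR_ge0.
- by move=> i; apply: measurable_funM => //; exact: measurable_gaussian.
- move=> i; under eq_integral do rewrite EFinM.
  rewrite ge0_integralZl_EFin//; last first.
    by apply/measurable_EFinP; exact: measurable_gaussian.
  by rewrite integral_gaussian ?subr_gt0.
apply: le_iintE => w.
  rewrite lee_fin mulr_ge0 ?Xweight_ge0// prodr_ge0// => i _.
  by rewrite mulr_ge0// expR_ge0.
rewrite lee_fin; apply: le_trans (ler_wpM2r _ (Xle w)) _.
  by apply: prodr_ge0 => i _; rewrite mulr_ge0// expR_ge0.
rewrite -mulrA ler_wpM2l// (big_morph expR (@expRD R) (@expR0 R)) -big_split /=.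
apply: ler_prod => i _; apply/andP; split.
  by rewrite mulr_ge0 ?expR_ge0// mulr_ge0 ?expR_ge0.
rewrite mulrCA /f ler_wpM2l// -expRD ler_expR.
by rewrite le_eqVlt; apply/orP; left; apply/eqP; have := a0 i => ai; field; lra.
Qed.

(** Only a box is kept, where each Gaussian factor is at least its value at distance [r i]. The box
    lies on one side of the centre; for the packets below this keeps the first frequency at least as
    large as at the centre. *)
Lemma XnormSq_wave_packet_ge s b a k B r : (forall i, 0 < a i) -> 0 <= B ->
  (forall i, 0 < r i) ->
  (forall w, (forall i, k 0 i <= w 0 i <= k 0 i + r i) -> B <= Xweight s b w) ->
  ((B * \prod_i (pi / a i * expR (- (r i ^+ 2 / (2 * a i))) * r i))%:E
    <= XnormSq s b (wave_packet a k))%E.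
Proof.
move=> a0 B0 r0 leX; rewrite XnormSq_wave_packet//.
pose c i := pi / a i * expR (- (r i ^+ 2 / (2 * a i))).
have c0 i : 0 <= c i by rewrite mulr_ge0 ?expR_ge0// divr_ge0 ?pi_ge0 ?ltW.
pose f i (x : R) : R := c i * \1_(`[k 0 i, k 0 i + r i]%classic) x.
rewrite -(@iintE_prod _ _ _ f)//; last 3 first.
- by move=> i x; rewrite mulr_ge0// indicE.
- by move=> i; apply: measurable_funM => //; exact: measurable_indic.
- move=> i; under eq_integral do rewrite EFinM.
  rewrite ge0_integralZl_EFin//; last first.
    by apply/measurable_EFinP; exact: measurable_indic.
  rewrite integral_indic//= setIT lebesgue_measure_itv /= lte_fin ltrDl r0.
  by rewrite -EFinB -EFinM addrAC subrr add0r.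
have f0 w : 0 <= B * \prod_i f i (w 0 i).
  by rewrite mulr_ge0// prodr_ge0// => i _; rewrite mulr_ge0// indicE.
apply: le_iintE => w; rewrite lee_fin//.
have g0 i : 0 <= pi / a i * expR (- ((w 0 i - k 0 i) ^+ 2 / (2 * a i))).
  by rewrite mulr_ge0 ?expR_ge0// divr_ge0 ?pi_ge0 ?ltW.
have [/forallP H|] := boolP [forall i, k 0 i <= w 0 i <= k 0 i + r i]; last first.
  move/forallPn => [i iP]; rewrite (bigD1 i)//= {1}/f indicE memNset ?mulr0 ?mul0r ?mulr0.
    by rewrite mulr_ge0 ?Xweight_ge0 ?prodr_ge0.
  by rewrite /= in_itv /=; exact/negP.
apply: ler_pM => //.
- by apply: prodr_ge0 => i _; rewrite mulr_ge0// indicE.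
- exact: leX.
- apply: ler_prod => i _; apply/andP; split; first by rewrite mulr_ge0 ?indicE.
  rewrite /f indicE mem_set ?mulr1; last by rewrite /= in_itv /=; exact: H.
  rewrite /c ler_wpM2l// ?divr_ge0 ?pi_ge0 ?(ltW (a0 i))//.
  rewrite ler_expR lerN2 ler_wpM2r ?invr_ge0 ?mulr_ge0 ?(ltW (a0 i))//.
  have /andP[h1 h2] := H i.
  by rewrite ler_sqr ?nnegrE ?subr_ge0// ?(ltW (r0 i))// lerBlDl.
Qed.

End wave_packet_norm.

(** * The weights along a packet *)

Section weights.
Context {R : realType} {n : nat}.
Implicit Types (L K s b : R) (w : 'rV[R]_n.+2).

(** The last coordinate is time, whose frequency scales like the square of the spatial ones. *)
Definition packet_width L (i : 'I_n.+2) : R := if i == ord_max then L ^+ 2 else L.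
Definition packet_center L K : 'rV[R]_n.+2 := \row_i (if i == ord0 then K * L else 0).
(** Squared distance to the centre in units of the widths: the squared transform of the packet
    decays like exp (- dist2 / 2), that of its cube like exp (- dist2 / 6). *)
Definition dist2 L K w : R :=
  \sum_i ((w 0 i - packet_center L K 0 i) / packet_width L i) ^+ 2.

Lemma packet_width_gt0 L i : 0 < L -> 0 < packet_width L i.
Proof. by move=> L0; rewrite /packet_width; case: ifP => // _; rewrite exprn_gt0. Qed.

Lemma prod_width L : \prod_i packet_width L i = L ^+ n.+3.
Proof.
rewrite big_ord_recr /= /packet_width eqxx.
under eq_bigr => i _.
  rewrite (_ : (_ == _) = false); last first.
    by rewrite -val_eqE /= ltn_eqF ?ltn_ord.
  over.
by rewrite prodr_const card_ord -exprD addn2.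
Qed.

Lemma dist2_ge0 L K w : 0 <= dist2 L K w.
Proof. by apply: sumr_ge0 => i _; rewrite sqr_ge0. Qed.

Lemma enorm_sqr N (z : 'rV[R]_N) : enorm z ^+ 2 = dotR z z.
Proof. by rewrite /enorm sqr_sqrtr ?dotR_ge0. Qed.

Lemma enorm_ge0 N (z : 'rV[R]_N) : 0 <= enorm z.
Proof. exact: sqrtr_ge0. Qed.

Section bounds.
Variables (L K : R) (w : 'rV[R]_n.+2).
Hypotheses (L1 : 1 <= L) (K1 : 1 <= K).
Let E := dist2 L K w.
Let x := enorm (spc w).

Let L0 : 0 < L. Proof. exact: lt_le_trans L1. Qed.
Let K0 : 0 < K. Proof. exact: lt_le_trans K1. Qed.
Let E0 : 0 <= E. Proof. exact: dist2_ge0. Qed.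
Let x0 : 0 <= x. Proof. exact: enorm_ge0. Qed.
Let LK1 : 1 <= L * K. Proof. exact: mulr_ege1. Qed.

Let D := \sum_(i < n.+1) (spc w 0 i - packet_center L K 0 (widen_ord (leqnSn n.+1) i)) ^+ 2.

Let dist2E : E * L ^+ 4 = D * L ^+ 2 + tim w ^+ 2.
Proof.
rewrite /E /dist2 big_ord_recr /= {2}/packet_width eqxx mxE (_ : (_ == _) = false)//.
rewrite subr0 mulrDl; congr (_ + _); last first.
  by rewrite /tim; field; rewrite gt_eqF.
rewrite /D !mulr_suml; apply: eq_bigr => i _.
rewrite /packet_width (_ : (_ == ord_max) = false); last first.
  by rewrite -val_eqE /= ltn_eqF ?ltn_ord.
by rewrite /spc mxE; field; rewrite gt_eqF.
Qed.

Let D_le : D <= E * L ^+ 2.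
Proof.
have L2 : 0 < L ^+ 2 by rewrite exprn_gt0.
rewrite -(ler_pM2r L2) -mulrA -exprD dist2E lerDl sqr_ge0.
by [].
Qed.

Lemma tim_le_dist2 : `|tim w| <= L ^+ 2 * (1 + E).
Proof.
have h : tim w ^+ 2 <= E * L ^+ 4.
  rewrite dist2E lerDr mulr_ge0 ?sqr_ge0//.
  by apply: sumr_ge0 => i _; rewrite sqr_ge0.
have L2 : 0 < L ^+ 2 by rewrite exprn_gt0.
have h2 : `|tim w| ^+ 2 <= (L ^+ 2 * (1 + E)) ^+ 2.
  rewrite real_normK ?num_real//; apply: (le_trans h).
  rewrite exprMn -exprM mulrC ler_wpM2l ?exprn_ge0 ?(ltW L0)//.
  by have := E0; nra.
by rewrite -(ler_pXn2r (_ : 0 < 2)%N)// nnegrE mulr_ge0 ?(ltW L2) ?addr_ge0.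
Qed.

Lemma enorm_sqr_le : x ^+ 2 <= 2 * L ^+ 2 * (K ^+ 2 + E).
Proof.
have h : x ^+ 2 <= 2 * D + 2 * (K * L) ^+ 2.
  rewrite /x enorm_sqr.
  have c2 : \sum_(i < n.+1) packet_center L K 0 (widen_ord (leqnSn n.+1) i) ^+ 2 =
      (K * L) ^+ 2.
    rewrite big_ord_recl mxE /= big1 ?addr0// => i _.
    by rewrite mxE /= expr0n.
  rewrite -c2 /D !mulr_sumr -big_split /=; apply: ler_sum => i _.
  set u := spc w 0 i; set v := packet_center _ _ _ _.
  by have := sqr_ge0 (u - 2 * v); nra.
have := D_le; rewrite exprMn in h; lra.
Qed.

Lemma enorm_sqr_ge : K ^+ 2 * L ^+ 2 <= 2 * x ^+ 2 + 2 * L ^+ 2 * E.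
Proof.
have h1 : spc w 0 ord0 ^+ 2 <= x ^+ 2.
  by rewrite /x enorm_sqr; exact: sqr_coord_le_dotR.
have h2 : (spc w 0 ord0 - K * L) ^+ 2 <= D.
  rewrite /D big_ord_recl [packet_center _ _ _ _]mxE /= lerDl.
  by apply: sumr_ge0 => i _; rewrite sqr_ge0.
set u := spc w 0 ord0 in h1 h2.
have := D_le; have := sqr_ge0 (2 * u - K * L); nra.
Qed.

Lemma enorm_dist2_le : 1 + x <= 3 * (L * K) * (1 + E).
Proof.
have h : x <= 2 * (L * K) * (1 + E).
  rewrite -(ler_pXn2r (_ : 0 < 2)%N)// ?nnegrE ?mulr_ge0 ?(ltW L0) ?(ltW K0) ?addr_ge0//.
  apply: (le_trans enorm_sqr_le).
  have -> : (2 * (L * K) * (1 + E)) ^+ 2 = 2 * L ^+ 2 * (2 * K ^+ 2 * (1 + E) ^+ 2).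
    by ring.
  rewrite ler_wpM2l ?mulr_ge0 ?exprn_ge0 ?(ltW L0)//.
  have K2 : 1 <= K ^+ 2 by rewrite exprn_ege1.
  have KE : 0 <= (K ^+ 2 - 1) * E by rewrite mulr_ge0 ?subr_ge0.
  have KE2 : 0 <= K ^+ 2 * E ^+ 2 by rewrite mulr_ge0 ?sqr_ge0.
  by rewrite sqrrD expr1n mul1r; have := E0; lra.
by have := E0; have := LK1; nra.
Qed.

Lemma modulation_dist2_le :
  1 + `|tim w + x ^+ 2| <= 4 * (L * K) ^+ 2 * (1 + E).
Proof.
have h1 := tim_le_dist2; have h2 := enorm_sqr_le.
have h3 : `|tim w + x ^+ 2| <= `|tim w| + x ^+ 2.
  by apply: le_trans (ler_normD _ _) _; rewrite (ger0_norm (sqr_ge0 _)).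
have K2 : 1 <= K ^+ 2 by rewrite exprn_ege1.
have L2 : 1 <= L ^+ 2 by rewrite exprn_ege1.
have h4 : L ^+ 2 * (1 + E) <= (L * K) ^+ 2 * (1 + E).
  by rewrite exprMn ler_wpM2r ?addr_ge0// ler_peMr// exprn_ge0 ?(ltW L0).
have h5 : 2 * L ^+ 2 * (K ^+ 2 + E) <= 2 * (L * K) ^+ 2 * (1 + E).
  have KE : K ^+ 2 + E <= K ^+ 2 * (1 + E).
    have KE : 0 <= (K ^+ 2 - 1) * E by rewrite mulr_ge0 ?subr_ge0.
    lra.
  have -> : 2 * (L * K) ^+ 2 * (1 + E) = 2 * L ^+ 2 * (K ^+ 2 * (1 + E)) by ring.
  by rewrite ler_wpM2l// mulr_ge0 ?exprn_ge0 ?(ltW L0).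
have h6 : 1 <= (L * K) ^+ 2 * (1 + E).
  by rewrite mulr_ege1 ?exprn_ege1// lerDl.
lra.
Qed.

(** By [enorm_sqr_ge], a deviation of at most K^2 / 4 takes away at most half of K^2 L^2, so [x]
    stays at least half its central value. *)
Lemma enorm_near_center_ge : E <= K ^+ 2 / 4 -> L * K / 2 <= 1 + x.
Proof.
move=> EK; apply: (@le_trans _ _ x); last by rewrite lerDr.
rewrite -(ler_pXn2r (_ : 0 < 2)%N)// ?nnegrE ?divr_ge0 ?mulr_ge0 ?(ltW L0) ?(ltW K0)//.
have h := enorm_sqr_ge.
have h2 : L ^+ 2 * E <= L ^+ 2 * (K ^+ 2 / 4) by rewrite ler_wpM2l ?exprn_ge0 ?(ltW L0).
rewrite !exprMn exprVn; nra.
Qed.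

End bounds.

Lemma box_dist2_le L K w : 0 < L ->
  (forall i, packet_center L K 0 i <= w 0 i <= packet_center L K 0 i + packet_width L i) ->
  dist2 L K w <= n.+2%:R.
Proof.
move=> L0 H; rewrite -[n.+2 in leRHS]card_ord -sumr_const.
apply: ler_sum => i _; have /andP[h1 h2] := H i.
have wi := packet_width_gt0 L i L0.
rewrite expr_le1// ?divr_ge0 ?subr_ge0 ?(ltW wi)//.
by rewrite ler_pdivrMr// mul1r lerBlDl.
Qed.

Lemma box_enorm_ge L K w : 0 < L -> 0 < K ->
  (forall i, packet_center L K 0 i <= w 0 i <= packet_center L K 0 i + packet_width L i) ->
  L * K <= enorm (spc w).
Proof.
move=> L0 K0 H; have := H ord0; rewrite mxE /= => /andP[h _].
rewrite -(ler_pXn2r (_ : 0 < 2)%N)// ?nnegrE ?enorm_ge0 ?mulr_ge0 ?(ltW L0) ?(ltW K0)//.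
rewrite enorm_sqr; apply: le_trans (sqr_coord_le_dotR _ _ ord0).
rewrite mxE (_ : widen_ord _ _ = ord0); last exact: val_inj.
by rewrite mulrC ler_pXn2r// nnegrE ?mulr_ge0 ?(ltW L0) ?(ltW K0)// (le_trans _ h)// mulr_ge0 ?ltW.
Qed.

End weights.

Section powR_facts.
Context {R : realType}.
Implicit Types x y r : R.

Lemma powR_ge1 x r : 1 <= x -> 0 <= r -> 1 <= x `^ r.
Proof. by move=> x1 r0; rewrite -[leLHS](powRr0 x) ler_powR. Qed.

Lemma le0_ger_powR x y r : 0 < x -> x <= y -> r <= 0 -> y `^ r <= x `^ r.
Proof.
move=> x0 xy r0; have y0 := lt_le_trans x0 xy.
rewrite -[r]opprK !(powRN _ (- r)) ler_pV2 ?inE ?unitfE ?gt_eqF ?powR_gt0//.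
by rewrite ge0_ler_powR ?nnegrE ?oppr_ge0// ltW.
Qed.

Lemma powR_le_exprn x r m : 1 <= x -> r <= m%:R -> x `^ r <= x ^+ m.
Proof.
by move=> x1 rm; rewrite -powR_mulrn ?(le_trans _ x1)// ler_powR.
Qed.

End powR_facts.

(** * Two-sided bounds for the weight in terms of powers of L K *)

Section packet_bounds.
Context {R : realType} {n : nat}.
Variables s b : R.
Implicit Types (L K : R) (w : 'rV[R]_n.+2).
Let bp := Num.max b 0.

Let bp0 : 0 <= bp. Proof. by rewrite le_max lexx orbT. Qed.
Let bbp : b <= bp. Proof. by rewrite le_max lexx. Qed.

(* The hypothesis on [K] absorbs the part of the packet near frequency 0, where
   for s < 0 the weight is of order 1 instead of (L K)^(2 s). *)
Lemma Xweight_le : exists2 C : R, 0 < C & forall L K w, 1 <= L -> 1 <= K ->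
  expR (- (K ^+ 2 / 64)) <= (L * K) `^ (2 * s) ->
  Xweight s b w <= C * (L * K) `^ (2 * s + 4 * bp) * expR (dist2 L K w / 8).
Proof.
pose m := Num.bound (2 * `|s|); pose m' := Num.bound (2 * bp).
have s0 : 0 <= 2 * `|s| by rewrite mulr_ge0.
have b0 : 0 <= 2 * bp by rewrite mulr_ge0.
have ms : 2 * `|s| <= m%:R by exact/ltW/archi_boundP.
have mb : 2 * bp <= m'%:R by exact/ltW/archi_boundP.
(* [m] and [m'] round the real exponents up to integers. Half of the available growth exp (dist2 /
   8) pays for the resulting powers of 1 + dist2, the other half for the region near frequency 0. *)
have [M M0 HM] := exprn_le_expR R (m + m') (1 / 16) ltac:(lra).
have c3 : 1 <= 3 `^ (2 * `|s|) :> R by apply: powR_ge1 => //; lra.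
(* The base 3 comes from [enorm_dist2_le] when s >= 0 and also covers the base 2 from
   [enorm_near_center_ge] when s < 0; the base 4 comes from [modulation_dist2_le]. *)
exists (3 `^ (2 * `|s|) * 4 `^ (2 * bp) * (M + 1)).
  by rewrite !mulr_gt0 ?powR_gt0 ?ltr_wpDl.
move=> L K w L1 K1 HK.
set E := dist2 L K w; have E0 : 0 <= E by exact: dist2_ge0.
have E1 : 1 <= 1 + E by rewrite lerDl.
have L0 : 0 < L by exact: lt_le_trans L1.
have K0 : 0 < K by exact: lt_le_trans K1.
have [L0' K0'] := (ltW L0, ltW K0).
have LK1 : 1 <= L * K by exact: mulr_ege1.
have LK0 : 0 < L * K by exact: mulr_gt0.
set x := enorm (spc w); have x0 : 0 <= x by exact: enorm_ge0.
have Em1 k : 1 <= (1 + E) ^+ k by rewrite exprn_ege1.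
have e1 : 1 <= expR (E / 16) by rewrite -[leLHS]expR0 ler_expR divr_ge0.
have h1 : (1 + x) `^ (2 * s) <=
    3 `^ (2 * `|s|) * (L * K) `^ (2 * s) * ((1 + E) ^+ m * expR (E / 16)).
  have [sge|slt] := leP 0 s.
    apply: (@le_trans _ _ ((3 * (L * K) * (1 + E)) `^ (2 * s))).
      rewrite ge0_ler_powR ?nnegrE ?mulr_ge0 ?addr_ge0 ?(ltW LK0)//.
      exact: enorm_dist2_le.
    rewrite !powRM ?mulr_ge0 ?(ltW LK0) ?addr_ge0// (ger0_norm sge).
    rewrite ler_wpM2l ?mulr_ge0 ?powR_ge0//.
    apply: (@le_trans _ _ ((1 + E) ^+ m)); last by rewrite ler_peMr// (le_trans _ (Em1 m)).
    by apply: powR_le_exprn => //; rewrite -(ger0_norm sge).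
  have s2 : 2 * s <= 0 by lra.
  have [EK|EK] := leP E (K ^+ 2 / 4).
    apply: (@le_trans _ _ ((L * K / 2) `^ (2 * s))).
      by apply: le0_ger_powR => //; [rewrite divr_gt0|exact: enorm_near_center_ge].
    rewrite powRM ?(ltW LK0)// (mulrC ((L * K) `^ _)).
    apply: (@le_trans _ _ (3 `^ (2 * `|s|) * (L * K) `^ (2 * s))); last first.
      by rewrite ler_peMr ?mulr_ege1// mulr_ge0 ?powR_ge0.
    rewrite ler_wpM2r ?powR_ge0//.
    have -> : 2^-1 `^ (2 * s) = 2 `^ (2 * `|s|) :> R.
      rewrite -[2^-1](powR_inv1 (ler0n _ 2)) -powRrM ltr0_norm//.
      by congr powR; ring.
    by rewrite ge0_ler_powR ?nnegrE// ler_nat.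
  (* Far from the centre with s < 0 the spatial weight is at most 1. Since E > K^2 / 4, exp (E / 16)
     exceeds exp (K^2 / 64), which explains the constant 64 in the hypothesis on [K]. *)
  apply: (@le_trans _ _ 1).
    rewrite -[leRHS](_ : 1 `^ (2 * s) = 1); last by rewrite powR1.
    by apply: le0_ger_powR => //; rewrite lerDl.
  apply: (@le_trans _ _ (expR (- (K ^+ 2 / 64)) * expR (E / 16))).
    rewrite -expRD -[leLHS]expR0 ler_expR; lra.
  apply: (@le_trans _ _ ((L * K) `^ (2 * s) * expR (E / 16))).
    by rewrite ler_wpM2r// expR_ge0.
  apply: ler_pM; rewrite ?powR_ge0 ?expR_ge0//.
    by rewrite ler_peMl// powR_ge0.
  by rewrite ler_peMl// expR_ge0.
have h2 : (1 + `|tim w + x ^+ 2|) `^ (2 * b) <=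
    4 `^ (2 * bp) * (L * K) `^ (4 * bp) * (1 + E) ^+ m'.
  apply: (@le_trans _ _ ((1 + `|tim w + x ^+ 2|) `^ (2 * bp))).
    by rewrite ler_powR ?lerDl// ler_wpM2l.
  apply: (@le_trans _ _ ((4 * (L * K) ^+ 2 * (1 + E)) `^ (2 * bp))).
    rewrite ge0_ler_powR ?nnegrE ?mulr_ge0 ?addr_ge0 ?exprn_ge0 ?(ltW LK0)//.
    exact: modulation_dist2_le.
  have <- : ((L * K) ^+ 2) `^ (2 * bp) = (L * K) `^ (4 * bp).
    by rewrite -powR_mulrn ?(ltW LK0)// -powRrM; congr powR; ring.
  rewrite -(powRM _ (ler0n _ 4)) ?exprn_ge0 ?(ltW LK0)//.
  rewrite powRM ?mulr_ge0 ?exprn_ge0 ?addr_ge0 ?(ltW LK0)//.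
  by rewrite ler_wpM2l ?powR_ge0// powR_le_exprn.
apply: le_trans (ler_pM _ _ h1 h2) _; rewrite ?powR_ge0//.
rewrite powRD; last by rewrite (gt_eqF LK0) implybT.
have e8 : expR (E / 8) = expR (E / 16) * expR (E / 16).
  by rewrite -expRD; congr expR; lra.
have hM := HM _ E0; rewrite exprD (_ : 1 / 16 * E = E / 16) in hM; last by lra.
set p3 := 3 `^ _; set p4 := 4 `^ _; set q1 := (L * K) `^ _; set q2 := (L * K) `^ _.
rewrite e8; set e := expR (E / 16) in hM *.
have -> : p3 * q1 * ((1 + E) ^+ m * e) * (p4 * q2 * (1 + E) ^+ m') =
  (p3 * p4 * (q1 * q2) * e) * ((1 + E) ^+ m * (1 + E) ^+ m') by ring.
have -> : p3 * p4 * (M + 1) * (q1 * q2) * (e * e) =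
  (p3 * p4 * (q1 * q2) * e) * ((M + 1) * e) by ring.
rewrite ler_wpM2l ?mulr_ge0 ?powR_ge0 ?expR_ge0//.
by apply: (le_trans hM); rewrite ler_wpM2r ?expR_ge0// lerDl.
Qed.

(** On the box 1 + dist2 is at most n + 3, so upper bounds on the brackets give lower bounds for
    their nonpositive powers: this treats the modulation, through -b >= -bp, and the spatial weight
    when s < 0. For s >= 0 the spatial frequency is at least L K there. *)
Lemma Xweight_ge : exists2 c : R, 0 < c & forall L K w, 1 <= L -> 1 <= K ->
  (forall i, packet_center L K 0 i <= w 0 i <= packet_center L K 0 i + packet_width L i) ->
  c * (L * K) `^ (2 * s - 4 * bp) <= Xweight s (- b) w.
Proof.
have n1 : 1 <= 3 * n.+3%:R :> R.
  by rewrite -natrM ler1n.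
have n4 : 1 <= 4 * n.+3%:R :> R.
  by rewrite -natrM ler1n.
exists ((3 * n.+3%:R) `^ (- (2 * `|s|)) * (4 * n.+3%:R) `^ (- (2 * bp))).
  by rewrite mulr_gt0 ?powR_gt0 ?(lt_le_trans _ n1) ?(lt_le_trans _ n4).
move=> L K w L1 K1 Hw.
have L0 : 0 < L by exact: lt_le_trans L1.
have K0 : 0 < K by exact: lt_le_trans K1.
have [L0' K0'] := (ltW L0, ltW K0).
have LK1 : 1 <= L * K by exact: mulr_ege1.
have LK0 : 0 < L * K by exact: mulr_gt0.
set x := enorm (spc w); have x0 : 0 <= x by exact: enorm_ge0.
have En : 1 + dist2 L K w <= n.+3%:R.
  by rewrite -[n.+3%:R]nat1r lerD2l box_dist2_le.
have h1 : (3 * n.+3%:R) `^ (- (2 * `|s|)) * (L * K) `^ (2 * s) <= (1 + x) `^ (2 * s).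
  have [sge|slt] := leP 0 s.
    apply: (@le_trans _ _ ((L * K) `^ (2 * s))).
      rewrite ler_piMl ?powR_ge0// powRN invf_le1 ?powR_gt0 ?(lt_le_trans _ n1)//.
      by rewrite powR_ge1// mulr_ge0.
    rewrite ge0_ler_powR ?nnegrE ?mulr_ge0 ?addr_ge0 ?(ltW LK0)//.
    by apply: le_trans (box_enorm_ge _ _ _ L0 K0 Hw) _; rewrite lerDr.
  rewrite (ltr0_norm slt) mulrN opprK -powRM ?(ltW LK0) ?(le_trans _ n1)//.
  apply: le0_ger_powR; [by rewrite ltr_wpDr| |lra].
  apply: le_trans (enorm_dist2_le _ _ w L1 K1) _.
  by rewrite mulrAC ler_wpM2r ?(ltW LK0)// ler_wpM2l.
have h2 : (4 * n.+3%:R) `^ (- (2 * bp)) * (L * K) `^ (- (4 * bp)) <=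
    (1 + `|tim w + x ^+ 2|) `^ (2 * - b).
  have z1 : 1 <= 1 + `|tim w + x ^+ 2| by rewrite lerDl.
  apply: (@le_trans _ _ ((1 + `|tim w + x ^+ 2|) `^ (- (2 * bp)))); last first.
    by rewrite ler_powR// mulrN lerN2 ler_wpM2l.
  have -> : (L * K) `^ (- (4 * bp)) = ((L * K) ^+ 2) `^ (- (2 * bp)).
    rewrite -powR_mulrn ?(ltW LK0)// -powRrM; congr powR; ring.
  rewrite -powRM ?exprn_ge0 ?(ltW LK0) ?(le_trans _ n4)//.
  apply: le0_ger_powR; [exact: lt_le_trans z1| |by rewrite oppr_le0 mulr_ge0].
  apply: le_trans (modulation_dist2_le _ _ w L1 K1) _.
  by rewrite mulrAC ler_wpM2r ?exprn_ge0 ?(ltW LK0)// ler_wpM2l.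
apply: le_trans (ler_pM _ _ h1 h2); rewrite ?mulr_ge0 ?powR_ge0//.
rewrite powRD; last by rewrite (gt_eqF LK0) implybT.
by rewrite mulrACA.
Qed.

End packet_bounds.

(** * Norms of the packet and of its cube *)

Section packet_norms.
Context {R : realType} {n : nat}.
Variables s b : R.
Implicit Types (L K : R).
Let bp := Num.max b 0.

Lemma sum_dist2 L K (w : 'rV[R]_n.+2) : 0 < L ->
  \sum_i (8 * packet_width L i ^+ 2)^-1 * (w 0 i - packet_center L K 0 i) ^+ 2 =
  dist2 L K w / 8.
Proof.
move=> L0; rewrite /dist2 mulr_suml; apply: eq_bigr => i _.
by field; rewrite gt_eqF// packet_width_gt0.
Qed.

Lemma XnormSq_packet_le : exists2 C : R, 0 < C & forall L K, 1 <= L -> 1 <= K ->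
  expR (- (K ^+ 2 / 64)) <= (L * K) `^ (2 * s) ->
  (XnormSq s b (wave_packet (fun i : 'I_n.+2 => (packet_width L i ^+ 2)%R) (packet_center L K))
    <= (C * (L * K) `^ (2 * s + 4 * bp) / L ^+ n.+3)%:E)%E.
Proof.
have [C C0 HC] := @Xweight_le R n s b.
(* A coordinate of width r contributes pi / r^2 times the integral of a Gaussian of rate 1 / (2 r^2)
   - 1 / (8 r^2) = 3 / (8 r^2), that is [c1] / r. *)
pose c1 : R := pi * Num.sqrt (8 * pi / 3).
have c10 : 0 < c1.
  by rewrite mulr_gt0 ?pi_gt0// sqrtr_gt0 divr_gt0// mulr_gt0// pi_gt0.
exists (C * c1 ^+ n.+2); first by rewrite mulr_gt0// exprn_gt0.
move=> L K L1 K1 HK; have L0 : 0 < L by exact: lt_le_trans L1.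
have r0 i := @packet_width_gt0 R n L i L0.
have a0 (i : 'I_n.+2) : 0 < packet_width L i ^+ 2 by exact: exprn_gt0.
pose th (i : 'I_n.+2) := (8 * packet_width L i ^+ 2)^-1.
have tha (i : 'I_n.+2) : th i < (2 * packet_width L i ^+ 2)^-1.
  by rewrite /th ltf_pV2 ?posrE ?mulr_gt0// ltr_pM2r// ltr_nat.
have A0 : 0 <= C * (L * K) `^ (2 * s + 4 * bp) by rewrite mulr_ge0 ?powR_ge0 ?ltW.
have Hw (w : 'rV[R]_n.+2) : Xweight s b w <= C * (L * K) `^ (2 * s + 4 * bp) *
    expR (\sum_i th i * (w 0 i - packet_center L K 0 i) ^+ 2).
  by rewrite sum_dist2//; exact: HC.
apply: le_trans (XnormSq_wave_packet_le _ _ _ _ _ _ a0 A0 tha Hw) _.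
rewrite lee_fin le_eqVlt; apply/orP; left; apply/eqP.
rewrite (_ : \prod_i _ = \prod_(i < n.+2) (c1 / packet_width L i)); last first.
  apply: eq_bigr => i _; have := r0 i; set r := packet_width L i => ri.
  have -> : pi / ((2 * r ^+ 2)^-1 - th i) = 8 * pi / 3 * r ^+ 2.
    by rewrite /th -/r; field; rewrite gt_eqF.
  rewrite sqrtrM ?divr_ge0 ?mulr_ge0 ?pi_ge0// sqrtr_sqr (gtr0_norm ri) /c1.
  by field; rewrite gt_eqF.
rewrite big_split /= prodr_const card_ord prodfV prod_width.
by field; rewrite gt_eqF ?exprn_gt0.
Qed.

(* Needed because [Xnorm] would be 0 on a function of infinite norm. *)
Lemma XnormSq_packet_cube_fin L K : 1 <= L -> 1 <= K ->
  expR (- (K ^+ 2 / 64)) <= (L * K) `^ (2 * s) ->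
  (XnormSq s (- b) (wave_packet (fun i : 'I_n.+2 => (3 * packet_width L i ^+ 2)%R)
    (packet_center L K)) < +oo)%E.
Proof.
move=> L1 K1 HK; have L0 : 0 < L by exact: lt_le_trans L1.
have [C C0 HC] := @Xweight_le R n s (- b).
have r0 i := @packet_width_gt0 R n L i L0.
have a0 (i : 'I_n.+2) : 0 < 3 * packet_width L i ^+ 2 by rewrite mulr_gt0 ?exprn_gt0.
pose th (i : 'I_n.+2) := (8 * packet_width L i ^+ 2)^-1.
(* The cube has the smaller rate 1 / (6 r^2); the allowance 1 / (8 r^2) in the weight bound was
   taken below it so that one bound serves both packets. *)
have tha (i : 'I_n.+2) : th i < (2 * (3 * packet_width L i ^+ 2))^-1.
  rewrite /th ltf_pV2 ?posrE ?mulr_gt0 ?exprn_gt0//.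
  by have := a0 i; lra.
have A0 : 0 <= C * (L * K) `^ (2 * s + 4 * Num.max (- b) 0).
  by rewrite mulr_ge0 ?powR_ge0 ?ltW.
have Hw (w : 'rV[R]_n.+2) : Xweight s (- b) w <= C * (L * K) `^ (2 * s + 4 * Num.max (- b) 0) *
    expR (\sum_i th i * (w 0 i - packet_center L K 0 i) ^+ 2).
  by rewrite sum_dist2//; exact: HC.
apply: le_lt_trans (XnormSq_wave_packet_le _ _ _ _ _ _ a0 A0 tha Hw) _.
exact: ltry.
Qed.

Lemma XnormSq_packet_cube_ge :
  exists2 c : R, 0 < c & forall L K, 1 <= L -> 1 <= K ->
  ((c * (L * K) `^ (2 * s - 4 * bp) / L ^+ n.+3)%:E <= XnormSq s (- b)
    (wave_packet (fun i : 'I_n.+2 => (3 * packet_width L i ^+ 2)%R) (packet_center L K)))%E.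
Proof.
have [c c0 Hc] := @Xweight_ge R n s b.
(* With rate parameter 3 r^2 and a box side r, each coordinate contributes pi / (3 r^2) * exp (- 1 /
   6) * r = [c2] / r. *)
pose c2 : R := pi / 3 * expR (- 6^-1).
have c20 : 0 < c2 by rewrite mulr_gt0 ?expR_gt0// divr_gt0 ?pi_gt0.
exists (c * c2 ^+ n.+2); first by rewrite mulr_gt0// exprn_gt0.
move=> L K L1 K1; have L0 : 0 < L by exact: lt_le_trans L1.
have r0 i := @packet_width_gt0 R n L i L0.
have a0 (i : 'I_n.+2) : 0 < 3 * packet_width L i ^+ 2 by rewrite mulr_gt0 ?exprn_gt0.
have B0 : 0 <= c * (L * K) `^ (2 * s - 4 * bp) by rewrite mulr_ge0 ?powR_ge0 ?ltW.
apply: le_trans (XnormSq_wave_packet_ge _ _ _ _ _ _ a0 B0 r0 (fun w => Hc L K w L1 K1)).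
rewrite lee_fin le_eqVlt; apply/orP; left; apply/eqP.
rewrite [in RHS](_ : \prod_i _ = \prod_(i < n.+2) (c2 / packet_width L i)); last first.
  apply: eq_bigr => i _; have := r0 i; set r := packet_width L i => ri.
  rewrite (_ : r ^+ 2 / (2 * (3 * r ^+ 2)) = 6^-1); last by field; rewrite gt_eqF.
  by rewrite /c2; field; rewrite gt_eqF.
rewrite big_split /= prodr_const card_ord prodfV prod_width.
by field; rewrite gt_eqF ?exprn_gt0.
Qed.

End packet_norms.

(** For L a power of K, (L K)^(2 s) is at worst polynomially small in K; this makes the Gaussian
    tail exp (- K^2 / 64) smaller still. The spare power of [K] absorbs the constant. *)
Lemma exprn_le_expR_sqr (R : realType) (q : nat) :
  exists2 M : R, 1 <= M & forall K : R, M <= K -> K ^+ q <= expR (K ^+ 2 / 64).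
Proof.
have [M M0 HM] := exprn_le_expR R q.+1 (1 / 64) ltac:(lra).
exists (M + 1); first by rewrite lerDr.
move=> K MK; have K1 : 1 <= K by apply: le_trans MK; rewrite lerDr.
have K0 : 0 < K by exact: lt_le_trans K1.
have := HM _ (sqr_ge0 K); rewrite (_ : 1 / 64 * _ = K ^+ 2 / 64); last by lra.
set e := expR _ => h.
have h2 : K ^+ q * K <= M * e.
  apply: le_trans h; rewrite -exprSr; apply: lerXn2r; rewrite ?nnegrE ?(ltW K0)//.
    by rewrite addr_ge0// sqr_ge0.
  by nra.
have h3 : M * e <= e * K.
  by rewrite mulrC ler_wpM2l ?expR_ge0//; lra.
by rewrite -(ler_pM2r K0); exact: le_trans h2 h3.
Qed.

(** * Choice of K and L, and the contradiction *)

Local Open Scope complex_scope.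

(** [C] may have any sign: the right-hand side dominates a square root, hence is nonnegative, and
    squaring preserves the order. *)
Lemma le_sqrtr_cube (R : realType) (C x y : R) : 0 <= x -> 0 <= y ->
  Num.sqrt y <= C * Num.sqrt x * Num.sqrt x * Num.sqrt x -> y <= C ^+ 2 * x ^+ 3.
Proof.
move=> x0 y0 h; have := sqr_sqrtr x0; have := sqr_sqrtr y0.
set p := Num.sqrt x in h *; set q := Num.sqrt y in h * => <- <-.
have -> : C ^+ 2 * (p ^+ 2) ^+ 3 = (C * p * p * p) ^+ 2 by ring.
have q0 : 0 <= q by exact: sqrtr_ge0.
by rewrite ler_sqr ?nnegrE// (le_trans q0 h).
Qed.

Theorem theorem1p5 (R : realType) (n : nat) (s b : R) :
  (2 <= n)%N -> s <= n%:R / 2 - 1 -> b < 1 / 2 ->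
  ~ (exists C : R, forall f g h : 'rV[R]_n.+1 -> R[i],
        schwartz f -> schwartz g -> schwartz h ->
        Xnorm s (- b) (fun z => f z * (g z)^* * h z)
          <= C * Xnorm s b f * Xnorm s b g * Xnorm s b h).
Proof.
case: n => // n _ sn b2 [C0 HC].
pose bp := Num.max b 0.
have bp0 : 0 <= bp by rewrite le_max lexx orbT.
have bp2 : bp < 1 / 2 by rewrite gt_max b2 /=; lra.
pose nn : R := n.+1%:R.
have nn0 : 0 <= nn by [].
have d0 : 0 < 8 - 16 * bp by lra.
(* The final comparison (m + 1) (2 nn - 4 + 16 bp) <= m (2 nn + 4) - 1 amounts to m (8 - 16 bp) >= 2
   nn - 3 + 16 bp, and the right side is below 2 nn + 5. Here [nn] is the space dimension, n + 1
   after the case split. *)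
pose m := Num.bound ((2 * nn + 5) / (8 - 16 * bp)).
have mP : 2 * nn + 5 <= m%:R * (8 - 16 * bp).
  rewrite -ler_pdivrMr//; apply/ltW/archi_boundP.
  by apply: divr_ge0; [lra|exact: ltW].
(* Since L K = K^(m + 1), this gives (L K)^(2 s) >= K^(- q), to be compared with exp (- K^2 /
   64). *)
pose q := Num.bound (2 * `|s| * m.+1%:R).
have qP : 2 * `|s| * m.+1%:R <= q%:R by apply/ltW/archi_boundP; rewrite !mulr_ge0.
have [M M1 HM] := exprn_le_expR_sqr R q.
have [C C_gt0 Hup] := @XnormSq_packet_le R n s b.
have [c c_gt0 Hlow] := @XnormSq_packet_cube_ge R n s b.
(* All constants of the squared estimate end up in [Q]; the contradiction will be K <= Q, so [K] is
   taken larger than both [Q] and the threshold [M]. *)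
pose Q := C0 ^+ 2 * C ^+ 3 / c.
have Q0 : 0 <= Q.
  by rewrite divr_ge0 ?(ltW c_gt0)// mulr_ge0 ?sqr_ge0// exprn_ge0 ?ltW.
pose K : R := M + Q.
have MK : M <= K by rewrite lerDl.
have K1 : 1 <= K by exact: le_trans MK.
have K0 : 0 < K by exact: lt_le_trans K1.
have QK : Q < K by rewrite ltrDr; exact: lt_le_trans M1.
pose L : R := K ^+ m.
have L1 : 1 <= L by rewrite exprn_ege1.
have L0 : 0 < L by exact: lt_le_trans L1.
have LKE : L * K = K `^ m.+1%:R by rewrite /L -exprSr powR_mulrn ?ltW.
have LK1 : 1 <= L * K by exact: mulr_ege1.
have LK0 : 0 < L * K by exact: mulr_gt0.
have HK : expR (- (K ^+ 2 / 64)) <= (L * K) `^ (2 * s).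
  apply: (@le_trans _ _ (K `^ (- q%:R))).
    rewrite powRN powR_mulrn ?(ltW K0)// expRN.
    by rewrite lef_pV2 ?posrE ?expR_gt0 ?exprn_gt0// HM.
  rewrite LKE -powRrM ler_powR//.
  have ms : m.+1%:R * (2 * - `|s|) <= m.+1%:R * (2 * s).
    by rewrite ler_wpM2l// ler_wpM2l// lerNl -normrN ler_norm.
  apply: le_trans ms; lra.
pose f := wave_packet (fun i : 'I_n.+2 => packet_width L i ^+ 2) (packet_center L K).
pose f3 := wave_packet (fun i : 'I_n.+2 => 3 * packet_width L i ^+ 2) (packet_center L K).
have Sf : schwartz f.
  by apply: schwartz_wave_packet => i; rewrite exprn_gt0// packet_width_gt0.
have := HC _ _ _ Sf Sf Sf.
have -> : (fun z => f z * (f z)^* * f z) = f3.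
  by apply/funext => z; exact: wave_packet_cube.
have X0 (s' b' : R) u : (0 <= @XnormSq R n.+1 s' b' u)%E.
  apply: iintE_ge0 => w; rewrite lee_fin mulr_ge0 ?Xweight_ge0//.
  by rewrite addr_ge0 ?sqr_ge0.
move=> /le_sqrtr_cube - /(_ (fine_ge0 (X0 _ _ _)) (fine_ge0 (X0 _ _ _))).
have {Hup} := Hup L K L1 K1 HK; rewrite -/f -/bp.
have {Hlow} := Hlow L K L1 K1; rewrite -/f3 -/bp.
have := @XnormSq_packet_cube_fin R n s b L K L1 K1 HK; rewrite -/f3.
(* Nonnegativity and the finite upper bounds leave only real values, on which [fine] is faithful. *)
move: (X0 s b f) (X0 s (- b) f3).
case: (XnormSq s (- b) f3) => // y; case: (XnormSq s b f) => // x.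
rewrite !lee_fin /= => x0 y0 _ hy hx hxy.
set T := (L * K) `^ (2 * s + 4 * bp) in hx; set T' := (L * K) `^ _ in hy.
pose d := n.+3.
have Ld : 0 < L ^+ d by rewrite exprn_gt0.
have T0 : 0 < T by rewrite powR_gt0.
have T'0 : 0 < T' by rewrite powR_gt0.
have h1 : c * T' / L ^+ d <= C0 ^+ 2 * (C * T / L ^+ d) ^+ 3.
  apply: (le_trans hy); apply: (le_trans hxy).
  rewrite ler_wpM2l ?sqr_ge0//; apply: lerXn2r => //; rewrite nnegrE//.
  exact: le_trans hx.
(* Three factors L^(-d) on the right against one on the left leave L^(2 d), with d the space
   dimension plus 2. *)
have h2 : L ^+ d ^+ 2 <= Q * (T ^+ 3 / T').
  have -> : Q * (T ^+ 3 / T') =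
      (C0 ^+ 2 * (C * T / L ^+ d) ^+ 3) * (L ^+ d ^+ 3 / (c * T')).
    by rewrite /Q; field; rewrite !gt_eqF.
  have -> : L ^+ d ^+ 2 = (c * T' / L ^+ d) * (L ^+ d ^+ 3 / (c * T')).
    by field; rewrite !gt_eqF.
  by rewrite ler_wpM2r// divr_ge0 ?exprn_ge0 ?mulr_ge0 ?ltW.
(* The exponent of L K is 3 (2 s + 4 bp) - (2 s - 4 bp) = 4 s + 16 bp. *)
have h3 : T ^+ 3 / T' = K `^ (m.+1%:R * (4 * s + 16 * bp)).
  rewrite -powR_mulrn ?(ltW T0)// /T /T' -powRN -powRrM -powRD; last first.
    by rewrite (gt_eqF LK0) implybT.
  by rewrite LKE -powRrM; congr powR; ring.
have h4 : L ^+ d ^+ 2 = K `^ (m%:R * (2 * nn + 4)).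
  rewrite /L -!exprM -powR_mulrn ?(ltW K0)//; congr powR.
  by rewrite !natrM /nn /d -[n.+3]addn2 natrD; ring.
(* The choice of [m] saves one full power of [K], which is then played against [Q]. *)
have h5 : K `^ (m%:R * (2 * nn + 4)) <= Q * K `^ (m%:R * (2 * nn + 4) - 1).
  rewrite -{1}h4; apply: (le_trans h2); rewrite h3 ler_wpM2l// ler_powR//.
  have sn' : 4 * s + 16 * bp <= 2 * nn - 4 + 16 * bp by rewrite /nn; lra.
  apply: (@le_trans _ _ (m.+1%:R * (2 * nn - 4 + 16 * bp))).
    by rewrite ler_wpM2l.
  rewrite -natr1; lra.
have h6 : K `^ (m%:R * (2 * nn + 4)) = K * K `^ (m%:R * (2 * nn + 4) - 1).
  rewrite -{2}[K](powRr1 (ltW K0)) -powRD ?(gt_eqF K0) ?implybT//.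
  by congr powR; ring.
by move: h5; rewrite h6 ler_pM2r ?powR_gt0// leNgt QK.
Qed.
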